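(* Let $\Sigma$ be a complete fan in $\mathbb Q^2$ with exactly three rays, let $\mathbb P=\mathbb P_\Sigma$ be the corresponding projective toric surface, let $L\subseteq\mathbb Z^3$ be the lattice associated to the rays of $\Sigma$, and let $I_{\mathbb P}\subseteq k[x_1,x_2,x_3]$ be the corresponding lattice ideal. Let $e$ be a point of the big torus of $\mathbb P$. The following are equivalent: (i) the Cox ring of $\mathrm{Bl}_e\mathbb P$ is generated in multiplicity $1$; (ii) $I_{\mathbb P}\not\subseteq\langle x_1,x_2,x_3\rangle^2$; (iii) $I_{\mathbb P}$ is a complete intersection.
   Context: The ground field $k$ is algebraically closed of characteristic $0$. Let $\rho_1,\rho_2,\rho_3\in N=\mathbb Z^2$ be the primitive generators of the rays of $\Sigma$, $M=\mathrm{Hom}(N,\mathbb Z)$; $L\subseteq\mathbb Z^3$ is the image of $M\to\mathbb Z^3$, $u\mapsto(\langle u,\rho_1\rangle,\langle u,\rho_2\rangle,\langle u,\rho_3\rangle)$. The lattice ideal is $I_{\mathbb P}=\langle x^{m^+}-x^{m^-} : m\in L\rangle$, where $m^+=(\max(m_i,0))_i$, $m^-=(-\min(m_i,0))_i$. It has codimension $2$, so it is a complete intersection when it is generated by two elements. The Cox ring of $\mathbb P$ is $R=k[x_1,x_2,x_3]$, graded by $\mathrm{Cl}(\mathbb P)$. The Cox ring of $\mathrm{Bl}_e\mathbb P$ is identified with the $\mathrm{Cl}(\mathbb P)\oplus\mathbb Z$-graded subalgebra of $R[t,t^{-1}]$ spanned by the elements $ft^{-i}$, $i\in\mathbb Z$,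 with $f\in R$ homogeneous such that the divisor of $f$ on $\mathbb P$ has multiplicity at least $i$ at $e$ (so $t$ corresponds to the exceptional divisor). It is generated in multiplicity $m$ if it is generated by $t$ together with homogeneous elements of the form $ft^{-i}$ with $f\in R$ and $0\le i\le m$. *)

(* Defs.v *)
From HB Require Import structures.
From mathcomp Require Import all_boot all_order all_algebra.
From mathcomp Require Export mpoly.

Set Implicit Arguments.
Unset Strict Implicit.
Unset Printing Implicit Defensive.

Import Order.TTheory GRing.Theory Num.Theory.
Local Open Scope ring_scope.

(* Cones in Q^d are predicates, compared extensionally; a rational polyhedral
   cone is given by a finite list of generators in Z^d. *)

Section Fans.
Variable d : nat.
Implicit Types (sigma tau : 'rV[rat]_d -> Prop) (s : seq 'rV[int]_d).

Definition to_rat (v : 'rV[int]_d) : 'rV[rat]_d := map_mx (intr : int -> rat) v.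

Definition cone s (v : 'rV[rat]_d) : Prop :=
  exists c : 'I_(size s) -> rat,
    (forall i, 0 <= c i) /\ v = \sum_(i < size s) c i *: to_rat s`_i.

Definition eq_cone sigma tau : Prop := forall v, sigma v <-> tau v.

Definition strongly_convex sigma : Prop :=
  forall v, sigma v -> sigma (- v) -> v = 0.

Definition dotp (K : pzSemiRingType) (u v : 'rV[K]_d) : K :=
  \sum_j u 0 j * v 0 j.

Definition is_face tau sigma : Prop :=
  exists u : 'rV[rat]_d,
    (forall v, sigma v -> 0 <= dotp u v) /\
    (forall v, tau v <-> sigma v /\ dotp u v = 0).

(* A list may represent the same cone several times, by different generators. *)
Definition is_fan (Sigma : seq (seq 'rV[int]_d)) : Prop :=
  [/\ forall s, s \in Sigma -> strongly_convex (cone s),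
      forall s tau, s \in Sigma -> is_face tau (cone s) ->
        exists2 s', s' \in Sigma & eq_cone tau (cone s')
    & forall s s', s \in Sigma -> s' \in Sigma ->
        is_face (fun v => cone s v /\ cone s' v) (cone s) /\
        is_face (fun v => cone s v /\ cone s' v) (cone s')].

Definition complete_fan (Sigma : seq (seq 'rV[int]_d)) : Prop :=
  is_fan Sigma /\ forall v, exists2 s, s \in Sigma & cone s v.

Definition is_ray sigma : Prop :=
  exists2 v : 'rV[int]_d, v != 0 & eq_cone sigma (cone [:: v]).

Definition primitive (v : 'rV[int]_d) : Prop :=
  forall (c : int) (w : 'rV[int]_d), v = c *: w -> `|c| = 1.

(* The fan has exactly n rays, and rho lists their primitive generators. *)
Definition primitive_ray_generators n (Sigma : seq (seq 'rV[int]_d))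
    (rho : 'I_n -> 'rV[int]_d) : Prop :=
  [/\ injective rho,
      forall i, primitive (rho i),
      forall i, exists2 s, s \in Sigma & eq_cone (cone s) (cone [:: rho i])
    & forall s, s \in Sigma -> is_ray (cone s) ->
        exists i, eq_cone (cone s) (cone [:: rho i])].

(* The map M -> Z^n, u |-> (<u, rho_i>)_i, with M = Z^d paired with N = Z^d by
   the dot product. *)
Definition ray_map n (rho : 'I_n -> 'rV[int]_d) (u : 'rV[int]_d) : 'rV[int]_n :=
  \row_i dotp u (rho i).

Definition ray_lattice n (rho : 'I_n -> 'rV[int]_d) (m : 'rV[int]_n) : Prop :=
  exists u : 'rV[int]_d, m = ray_map rho u.

End Fans.

Section Ideals.
Variable A : comNzRingType.
Implicit Types (S I J : A -> Prop).

Definition ideal_gen S (x : A) : Prop :=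
  exists s : seq (A * A),
    (forall p, p \in s -> S p.2) /\ x = \sum_(p <- s) p.1 * p.2.

Definition ideal_mul I J : A -> Prop :=
  ideal_gen (fun x => exists a b, [/\ I a, J b & x = a * b]).

Fixpoint ideal_pow I (n : nat) : A -> Prop :=
  if n is n'.+1 then ideal_mul I (ideal_pow I n') else fun=> True.

Definition ideal_sub I J : Prop := forall x, I x -> J x.

End Ideals.

Section LatticeIdeal.
Variables (k : fieldType) (n : nat).

Definition pos_part (m : 'rV[int]_n) : 'X_{1..n} :=
  [multinom `|Num.max (m 0%R i) 0|%N | i < n].

Definition neg_part (m : 'rV[int]_n) : 'X_{1..n} :=
  [multinom `|- Num.min (m 0%R i) 0|%N | i < n].

Definition lattice_ideal (L : 'rV[int]_n -> Prop) : {mpoly k[n]} -> Prop :=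
  ideal_gen (fun f => exists2 m, L m & f = 'X_[pos_part m] - 'X_[neg_part m]).

Definition irrelevant_ideal : {mpoly k[n]} -> Prop :=
  ideal_gen (fun f => exists i, f = 'X_i).

(* The maximal ideal of a k-point of affine n-space. *)
Definition point_ideal (e : 'I_n -> k) : {mpoly k[n]} -> Prop :=
  ideal_gen (fun f => exists j, f = 'X_j - (e j)%:MP).

End LatticeIdeal.

(* For ideals of codimension 2. *)
Definition complete_intersection2 (A : comNzRingType) (I : A -> Prop) : Prop :=
  exists f g : A, forall x, I x <-> ideal_gen (fun y => y = f \/ y = g) x.

Section CoxRing.
Variables (k : fieldType) (rho : 'I_3 -> 'rV[int]_2).
Implicit Types (f : {mpoly k[3]}) (i : int).

Definition int_exp n (m : 'X_{1..n}) : 'rV[int]_n := \row_j (m j)%:Z.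

(* Cl(P) is the quotient of Z^3 by the lattice of the rays. *)
Definition Cl_homogeneous f : Prop :=
  forall m m', m \in msupp f -> m' \in msupp f ->
    ray_lattice rho (int_exp m - int_exp m').

(* The coefficient of f, seen as a Laurent polynomial, at v in Z^3. *)
Definition coefZ f (v : 'rV[int]_3) : k :=
  if [forall i, 0 <= v 0 i] then f@_(pos_part v) else 0.

(* On the big torus Spec k[M], with k[M] = k[y_1^(+-1), y_2^(+-1)], the divisor
   of a homogeneous f is cut out by the g in k[M] with
     f = x^a * sum_(u in M) g_u x^(<u,rho_1>, <u,rho_2>, <u,rho_3>),
   where x^a is a Laurent monomial of the degree of f.  Changing a within its
   class multiplies g by a monomial, a unit of k[M], so a may be chosen such
   that g is a polynomial in y_1, y_2. *)
Definition torus_equation f (g : {mpoly k[2]}) : Prop :=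
  exists a : 'rV[int]_3,
    (forall u : 'X_{1..2}, g@_u = coefZ f (a + ray_map rho (int_exp u))) /\
    (forall m : 'X_{1..3}, m \in msupp f ->
       exists u : 'X_{1..2}, int_exp m = a + ray_map rho (int_exp u)).

(* The divisor of f has multiplicity at least i at the point e of the torus,
   given by the values of the characters y_1, y_2; no condition if i <= 0. *)
Definition mult_ge (e : 'I_2 -> k) f i : Prop :=
  exists2 g, torus_equation f g
    & ideal_pow (point_ideal e) `|Num.max i 0|%N g.

(* R[t, t^-1] is realised inside the fraction field of R[t]. *)
Definition ambient : fieldType := {fraction {poly {mpoly k[3]}}}.

Definition in_ambient f : ambient := FracField.tofrac f%:P.
Definition kconst (c : k) : ambient := in_ambient c%:MP.
Definition tvar : ambient :=
  FracField.tofrac ('X : {poly {mpoly k[3]}}).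

Definition bihom (f : {mpoly k[3]}) (i : int) : ambient :=
  in_ambient f * tvar ^ (- i).

Definition lin_span (S : ambient -> Prop) (z : ambient) : Prop :=
  exists s : seq (k * ambient),
    (forall p, p \in s -> S p.2) /\ z = \sum_(p <- s) kconst p.1 * p.2.

Inductive subalg_gen (S : ambient -> Prop) : ambient -> Prop :=
| subalg_scalar c : subalg_gen S (kconst c)
| subalg_elt z : S z -> subalg_gen S z
| subalg_add z z' :
    subalg_gen S z -> subalg_gen S z' -> subalg_gen S (z + z')
| subalg_mul z z' :
    subalg_gen S z -> subalg_gen S z' -> subalg_gen S (z * z').

Definition cox_homogeneous (e : 'I_2 -> k) f i : Prop :=
  Cl_homogeneous f /\ mult_ge e f i.

(* The Cox ring of the blowup of P at e, as a subalgebra of R[t, t^-1]. *)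
Definition cox_ring (e : 'I_2 -> k) : ambient -> Prop :=
  lin_span (fun z => exists f i, cox_homogeneous e f i /\ z = bihom f i).

Definition cox_generated_in_mult (e : 'I_2 -> k) (m : int) : Prop :=
  exists G : ambient -> Prop,
    (forall z, G z -> exists f i,
       [/\ cox_homogeneous e f i, 0 <= i <= m & z = bihom f i]) /\
    (forall z, cox_ring e z <-> subalg_gen (fun w => w = tvar \/ G w) z).

End CoxRing.

(* Main.v *)
Require Import Defs.
From mathcomp Require Import all_boot all_order all_algebra.
From mathcomp Require Import ssrcomplements zify ring lra.
From Stdlib Require Import Classical.
Import Order.TTheory GRing.Theory Num.Theory.
Set Implicit Arguments.
Unset Strict Implicit.
Unset Printing Implicit Defensive.
Local Open Scope ring_scope.

(* Since the rays positively span the plane, no nonzero relation in the lattice L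
   has all its entries of one sign, and each coordinate maps L onto Z because the
   rho_i are primitive.  Hence (ii) says that L contains a relation
   x_i = x_j^b x_k^c (linear_relation).

   If it does, L is generated by this relation and by some x_j^P = x_k^Q; the two
   binomials f, g generate I_P.  A form F = sum_d f^d H_d(x_j, x_k) vanishes to
   order n at e only if g^(n-d) divides H_d for d < n, as one sees by testing the
   Laurent polynomial of F against polynomial functions on the character lattice;
   so the Cox ring is generated by t, the x_i, f/t and g/t.

   Let c_i be the least exponent such that x_i^(c_i) is equal modulo I_P to a
   monomial in the other variables.  If I_P has two generators, the three
   corresponding binomials are dependent modulo (x_1, x_2, x_3) I_P, in which no
   x_i^(c_i) occurs; so x_i^(c_i) - x_j^(c_j) is in I_P for some i, j, and
   surjectivity onto the third coordinate gives a linear relation.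

   If there is no linear relation, the three minimal relations p, q, r can be
   chosen without zero entries, and then p + q + r = 0 (Herzog).  The form
   x^g (x^p + x^q + x^r - 3), with g minimal, vanishes to order 2 at e, but is not
   a combination of products of two forms vanishing at e. *)

(** * Rays of a complete fan *)

Lemma rV2P (K : Type) (u v : 'rV[K]_2) : u 0 0 = v 0 0 -> u 0 1 = v 0 1 -> u = v.
Proof.
move=> h0 h1; apply/rowP => i.
by case: (unliftP ord0 i) => [j|] -> //; rewrite ?ord1 //;
  move: h1; congr (u 0 _ = v 0 _); apply/val_inj.
Qed.

Lemma dotp2E (K : pzSemiRingType) (u v : 'rV[K]_2) :
  dotp u v = u 0 0 * v 0 0 + u 0 1 * v 0 1.
Proof. by rewrite /dotp !big_ord_recl big_ord0 addr0; congr (_ + u 0 _ * v 0 _); apply/val_inj. Qed.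

Section DotProduct.
Variables (K : comPzRingType) (d : nat).
Implicit Types u v w : 'rV[K]_d.

Lemma dotpDl u v w : dotp (u + v) w = dotp u w + dotp v w.
Proof. by rewrite -big_split; apply: eq_bigr => i _; rewrite mxE mulrDl. Qed.

Lemma dotpZl c u v : dotp (c *: u) v = c * dotp u v.
Proof. by rewrite /dotp mulr_sumr; apply: eq_bigr => i _; rewrite mxE mulrA. Qed.

Lemma dotpC u v : dotp u v = dotp v u.
Proof. by apply: eq_bigr => i _; rewrite mulrC. Qed.

Lemma dotpDr u v w : dotp u (v + w) = dotp u v + dotp u w.
Proof. by rewrite !(dotpC u) dotpDl. Qed.

Lemma dotpZr c u v : dotp u (c *: v) = c * dotp u v.
Proof. by rewrite !(dotpC u) dotpZl. Qed.

Lemma dotp0r u : dotp u 0 = 0.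
Proof. by rewrite -(scale0r 0) dotpZr mul0r. Qed.

Lemma dotp0l u : dotp 0 u = 0.
Proof. by rewrite dotpC dotp0r. Qed.

Lemma dotp_sumr n u (F : 'I_n -> 'rV[K]_d) :
  dotp u (\sum_i F i) = \sum_i dotp u (F i).
Proof. by elim/big_rec2: _ => [|i x y _ <-]; rewrite ?dotp0r ?dotpDr. Qed.

End DotProduct.

Lemma dotp_to_rat d (u v : 'rV[int]_d) :
  dotp (to_rat u) (to_rat v) = (dotp u v)%:~R.
Proof. by rewrite /dotp rmorph_sum; apply: eq_bigr => i _; rewrite !mxE rmorphM. Qed.

Lemma primitive_neq0 d (v : 'rV[int]_d) : primitive v -> v != 0.
Proof.
move=> hv; apply/eqP => v0.
by have := hv 0 0; rewrite v0 scaler0 normr0 => /(_ erefl).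
Qed.

Lemma to_rat_neq0 d (v : 'rV[int]_d) : v != 0 -> to_rat v != 0.
Proof.
apply: contra => /eqP h; apply/eqP/rowP => i.
by have /rowP/(_ i)/eqP := h; rewrite !mxE intr_eq0 => /eqP.
Qed.

(** Dividing [v] by the gcd of its entries exhibits [v] as a multiple of a lattice vector, so
    primitivity forces that gcd to be 1. *)
Lemma primitive_Bezout (v : 'rV[int]_2) : primitive v -> exists u, dotp u v = 1.
Proof.
move=> hv; have [a [b hab]] := Bezoutz (v 0 0) (v 0 1).
exists (\row_i (if i == 0 then a else b)).
rewrite dotp2E !mxE /= hab.
have := hv (gcdz (v 0 0) (v 0 1))
  (\row_i divz (v 0 i) (gcdz (v 0 0) (v 0 1))).
have -> : `|gcdz (v 0 0) (v 0 1)| = gcdz (v 0 0) (v 0 1) by [].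
by apply; apply: rV2P; rewrite !mxE mulrC divzK ?dvdz_gcdl ?dvdz_gcdr.
Qed.

(** Pairing with Bezout covectors of [a] and of [b] shows that [r] and its inverse are both
    integers. *)
Lemma primitive_collinear (a b : 'rV[int]_2) (r : rat) :
  primitive a -> primitive b -> 0 < r -> r *: to_rat a = to_rat b -> a = b.
Proof.
move=> ha hb r0 hr.
have [u hu] := primitive_Bezout ha; have [w hw] := primitive_Bezout hb.
have e1 : r = (dotp u b)%:~R.
  by rewrite -dotp_to_rat -hr dotpZr dotp_to_rat hu mulr1.
have e2 : r * (dotp w a)%:~R = 1.
  by rewrite -dotp_to_rat -dotpZr hr dotp_to_rat hw.
have h3 : dotp u b * dotp w a = 1.
  by apply/eqP; rewrite -(eqr_int rat) rmorphM /= -e1 e2.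
have h4 : 0 < dotp u b by rewrite -(ltr0z rat) -e1.
have h5 : dotp u b = 1.
  move: h3 h4; move: (dotp u b) (dotp w a) => x y hxy hx.
  have hy : 0 < y by rewrite -(pmulr_rgt0 _ hx) hxy.
  by nia.
apply/rowP => i; apply/eqP; rewrite -(eqr_int rat).
by have /rowP/(_ i) := hr; rewrite e1 h5 scale1r !mxE => ->.
Qed.

Section Cones.
Variable d : nat.
Implicit Types (s : seq 'rV[int]_d) (u v : 'rV[rat]_d).

Lemma cone_gen s g : g \in s -> cone s (to_rat g).
Proof.
move=> gs; have hi : (index g s < size s)%N by rewrite index_mem.
exists (fun i => (i == Ordinal hi)%:R); split; first by move=> i; rewrite ler0n.
rewrite (bigD1 (Ordinal hi)) //= eqxx scale1r nth_index // big1 ?addr0 //.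
by move=> i /negPf ->; rewrite scale0r.
Qed.

Lemma cone1P g v : cone [:: g] v <-> exists2 x : rat, 0 <= x & v = x *: to_rat g.
Proof.
split=> [[c [hc ->]]|[x hx ->]].
  by exists (c ord0); rewrite //= big_ord_recl big_ord0 addr0.
by exists (fun=> x); split=> //=; rewrite big_ord_recl big_ord0 addr0.
Qed.

Lemma cone_dotp_ge0 s u v : (forall g, g \in s -> 0 <= dotp u (to_rat g)) ->
  cone s v -> 0 <= dotp u v.
Proof.
move=> h [c [hc ->]]; rewrite dotp_sumr sumr_ge0 // => i _.
by rewrite dotpZr mulr_ge0 // h // mem_nth.
Qed.

Lemma cone_dotp_lt0 s u v : cone s v -> dotp u v < 0 ->
  exists2 g, g \in s & dotp u (to_rat g) < 0.
Proof.
move=> hv hu; case: (boolP (has (fun g => dotp u (to_rat g) < 0) s)).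
  by move=> /hasP [g]; exists g.
move=> /hasPn h; move: hu; rewrite ltNge (cone_dotp_ge0 _ hv) // => g /h.
by rewrite -leNgt.
Qed.

End Cones.

Lemma ex_min_ratio (T : eqType) (s : seq T) (P : pred T) (f : T -> rat) :
  has P s -> exists2 x, x \in s & P x /\ forall y, y \in s -> P y -> f x <= f y.
Proof.
elim: s => //= a s IH.
case: (boolP (has P s)) => [/IH [x xs [Px hx]] _|].
  case: (boolP (P a && (f a <= f x))) => [/andP [Pa hax]|].
    exists a; rewrite ?mem_head //; split=> // y.
    rewrite inE => /orP [/eqP -> //|ys Py]; exact: le_trans hax (hx _ ys Py).
  move=> hax; exists x; rewrite ?inE ?xs ?orbT //; split=> // y.
  rewrite inE => /orP [/eqP -> Pa|]; last exact: hx.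
  by move: hax; rewrite Pa /= -ltNge => /ltW.
move=> /hasPn h; rewrite orbF => Pa; exists a; rewrite ?mem_head //.
by split=> // y; rewrite inE => /orP [/eqP ->|/h /negPf ->].
Qed.

(** The quarter turn: [dotp (rotv u) v] is the determinant of [u] and [v]. *)
Definition rotv (K : pzRingType) (u : 'rV[K]_2) : 'rV[K]_2 :=
  \row_i (if i == 0 then - u 0 1 else u 0 0).

Lemma dotp_rotv (K : pzRingType) (u v : 'rV[K]_2) :
  dotp (rotv u) v = u 0 0 * v 0 1 - u 0 1 * v 0 0.
Proof. by rewrite dotp2E !mxE /= addrC mulNr. Qed.

Lemma dotp_ker_collinear (K : fieldType) (u v w : 'rV[K]_2) :
  u != 0 -> w != 0 -> dotp u v = 0 -> dotp u w = 0 -> exists x, v = x *: w.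
Proof.
rewrite !dotp2E => hu hw hv huw.
have hd : v 0 0 * w 0 1 = v 0 1 * w 0 0.
  apply/eqP; rewrite -subr_eq0; apply: contraNT hu => hd.
  have h0 : u 0 0 * (v 0 0 * w 0 1 - v 0 1 * w 0 0) = 0.
    transitivity (w 0 1 * (u 0 0 * v 0 0 + u 0 1 * v 0 1) -
      v 0 1 * (u 0 0 * w 0 0 + u 0 1 * w 0 1)); first by ring.
    by rewrite hv huw; ring.
  have h1 : u 0 1 * (v 0 0 * w 0 1 - v 0 1 * w 0 0) = 0.
    transitivity (v 0 0 * (u 0 0 * w 0 0 + u 0 1 * w 0 1) -
      w 0 0 * (u 0 0 * v 0 0 + u 0 1 * v 0 1)); first by ring.
    by rewrite hv huw; ring.
  move: h0 h1 => /eqP; rewrite mulf_eq0 (negPf hd) orbF => /eqP h0.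
  move=> /eqP; rewrite mulf_eq0 (negPf hd) orbF => /eqP h1.
  by apply/eqP/rV2P; rewrite mxE.
case: (altP (w 0 0 =P 0)) => [w0|w0].
  have w1 : w 0 1 != 0.
    by apply: contra hw => /eqP w1; apply/eqP/rV2P; rewrite mxE.
  exists (v 0 1 / w 0 1); apply: rV2P; rewrite !mxE ?divfK //.
  rewrite w0 mulr0; move: hd; rewrite w0 mulr0 => /eqP.
  by rewrite mulf_eq0 (negPf w1) orbF => /eqP.
exists (v 0 0 / w 0 0); apply: rV2P; rewrite !mxE ?divfK //.
by rewrite mulrAC hd mulfK.
Qed.

Section FanPart.
Variables (Sigma : seq (seq 'rV[int]_2)) (rho : 'I_3 -> 'rV[int]_2).
Hypothesis hSigma : complete_fan Sigma.
Hypothesis hrho : primitive_ray_generators Sigma rho.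

(** The functionals cutting out the intersections of the cone with two different rays are
    nonnegative on it; their sum vanishes only at points common to both rays, that is, at 0. *)
Lemma cone_pos_functional s : s \in Sigma ->
  exists u, forall v, cone s v -> v != 0 -> 0 < dotp u v.
Proof.
move=> hs; have [hinj hprim hrays _] := hrho.
have [[_ _ hface] _] := hSigma.
have [s0 hs0 e0] := hrays 0; have [s1 hs1 e1] := hrays 1.
have [[u0 [p0 z0]] _] := hface _ _ hs hs0.
have [[u1 [p1 z1]] _] := hface _ _ hs hs1.
exists (u0 + u1) => v hv vn0; rewrite dotpDl lt_neqAle addr_ge0 ?p0 ?p1 //.
rewrite andbT eq_sym paddr_eq0 ?p0 ?p1 //; apply/negP => /andP [/eqP d0 /eqP d1].
have [_ /e0/cone1P [x hx ex]] : cone s v /\ cone s0 v by apply/z0.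
have [_ /e1/cone1P [y hy ey]] : cone s v /\ cone s1 v by apply/z1.
have x0 : x != 0 by apply: contra vn0 => /eqP x0; rewrite ex x0 scale0r.
have y0 : y != 0 by apply: contra vn0 => /eqP y0; rewrite ey y0 scale0r.
suff /hinj : rho 0 = rho 1 by [].
apply: (@primitive_collinear _ _ (x / y)) => //.
  by rewrite divr_gt0 ?lt_neqAle 1?eq_sym ?x0 ?y0.
by rewrite mulrC -scalerA -ex ey scalerA mulVf // scale1r.
Qed.

(** At a generator minimizing the ratio of [l] to [u], the functional [l + c *: u] vanishes, and it
    is nonnegative on the cone. If it is nonzero, its zeros in the cone form a one-dimensional face,
    hence a ray of the fan. *)
Lemma cone_extremal_ray s u l (g : 'rV[int]_2) : s \in Sigma -> g \in s -> g != 0 ->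
  (forall v, cone s v -> v != 0 -> 0 < dotp u v) ->
  exists2 g, g \in s /\ g != 0 &
  let c := - (dotp l (to_rat g) / dotp u (to_rat g)) in
  (forall h, h \in s -> 0 <= dotp (l + c *: u) (to_rat h)) /\
  (l + c *: u != 0 -> exists i x, 0 < x /\ to_rat (rho i) = x *: to_rat g).
Proof.
move=> hs gs gn0 hu.
have [g0 g0s [g0n0 hmin]] : exists2 x, x \in s & x != 0 /\ forall y, y \in s ->
    y != 0 -> dotp l (to_rat x) / dotp u (to_rat x) <=
              dotp l (to_rat y) / dotp u (to_rat y).
  by apply: (@ex_min_ratio _ s (fun x => x != 0)); apply/hasP; exists g.
exists g0 => // c.
have upos h : h \in s -> h != 0 -> 0 < dotp u (to_rat h).
  by move=> hhs hn0; apply: hu; rewrite ?to_rat_neq0 //; apply: cone_gen.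
have hge h : h \in s -> 0 <= dotp (l + c *: u) (to_rat h).
  case: (altP (h =P 0)) => [->|hn0] hhs.
    by rewrite (_ : to_rat 0 = 0) ?dotp0r //; apply/rowP => i; rewrite !mxE.
  by rewrite dotpDl dotpZl mulNr subr_ge0 -ler_pdivlMr ?upos ?hmin.
split=> // hne.
have [[_ hfaces _] _] := hSigma; have [_ hprim _ hray] := hrho.
pose tau v := cone s v /\ dotp (l + c *: u) v = 0.
have ftau : is_face tau (cone s).
  by exists (l + c *: u); split=> // v; apply: cone_dotp_ge0.
have g0tau : tau (to_rat g0).
  split; first exact: cone_gen.
  by rewrite dotpDl dotpZl mulNr divfK ?subrr // gt_eqF ?upos.
have [s' hs' es'] := hfaces _ _ hs ftau.
have etau : eq_cone tau (cone [:: g0]).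
  move=> v; split=> [[hv hv0]|/cone1P [x hx ->]]; last first.
    split; last by rewrite dotpZr (proj2 g0tau) mulr0.
    case: (cone_gen g0s) => a [ha ->]; exists (fun i => x * a i); split.
      by move=> i; rewrite mulr_ge0.
    by rewrite scaler_sumr; apply: eq_bigr => i _; rewrite scalerA.
  have [x ex] := dotp_ker_collinear hne (to_rat_neq0 g0n0) hv0 (proj2 g0tau).
  apply/cone1P; exists x => //; rewrite leNgt; apply/negP => xlt0.
  have vn0 : v != 0 by rewrite ex scaler_eq0 negb_or lt_eqF ?to_rat_neq0.
  have := hu _ hv vn0; rewrite ex dotpZr nmulr_rgt0 // ltNge ltW // upos //.
have [i hi] : exists i, eq_cone (cone s') (cone [:: rho i]).
  apply: hray => //; exists g0 => // v; split.
    by move=> /es'/etau.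
  by move=> /etau/es'.
have /hi/es'/etau/cone1P [x hx ex] : cone [:: rho i] (to_rat (rho i)).
  by apply: cone_gen; rewrite inE.
exists i, x; split=> //; rewrite lt_neqAle hx andbT eq_sym.
apply: contra (to_rat_neq0 (primitive_neq0 (hprim i))) => /eqP x0.
by rewrite ex x0 scale0r.
Qed.

(** By completeness some cone contains [- l], so [l] is negative at one of its generators. In
    general the generator of least ratio then spans a ray on which [l] is negative. *)
Lemma rays_positively_span l : l != 0 -> exists i, dotp l (to_rat (rho i)) < 0.
Proof.
move=> ln0; have [_ hcomp] := hSigma.
have hl : dotp l (- l) < 0.
  rewrite -scaleN1r dotpZr mulN1r oppr_lt0 dotp2E.
  rewrite lt_neqAle addr_ge0 ?sqr_ge0 // andbT eq_sym.
  rewrite paddr_eq0 ?sqr_ge0 // !mulf_eq0 !orbb.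
  by apply: contra ln0 => /andP [/eqP h0 /eqP h1]; apply/eqP/rV2P; rewrite mxE.
have [s hs hv] := hcomp (- l).
have [g gs hg] := cone_dotp_lt0 hv hl.
have gn0 : g != 0.
  apply: contraL hg => /eqP ->.
  by rewrite (_ : to_rat 0 = 0) ?dotp0r ?ltxx //; apply/rowP => i; rewrite !mxE.
have [u hu] := cone_pos_functional hs.
have [g0 [g0s g0n0] /=] := cone_extremal_ray l hs gs gn0 hu.
set c := - _ => -[hge hray].
have upos h : h \in s -> h != 0 -> 0 < dotp u (to_rat h).
  by move=> hhs hn0; apply: hu; rewrite ?to_rat_neq0 //; apply: cone_gen.
have c0 : 0 < c.
  have := hge _ gs; rewrite dotpDl dotpZl => h.
  by rewrite -(pmulr_lgt0 _ (upos _ gs gn0)); lra.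
(* In the degenerate case [l] is a negative multiple of [u], hence negative on the whole cone
   outside 0, and any ray of the cone serves; the quarter turn of [u] produces one. *)
case: (altP (l + c *: u =P 0)) => [e|hne].
  have [h [hhs hn0] /= [_]] := cone_extremal_ray (rotv u) hs gs gn0 hu.
  set c' := - _ => hray'.
  have [|i [x [x0 ex]]] := hray'.
    (* The quarter turn of [u] is not a multiple of [u]: otherwise [(1 + c' ^+ 2) *: u = 0]. *)
    apply: contraTN (upos _ gs gn0) => /eqP /rowP e'.
    have := e' 0; have := e' 1; rewrite !mxE /= => e1 e0.
    have h0 : (1 + c' ^+ 2) * u 0 0 = 0.
      transitivity ((u 0 0 + c' * u 0 1) + c' * (- u 0 1 + c' * u 0 0)); first by ring.
      by rewrite e0 e1; ring.
    have h1 : (1 + c' ^+ 2) * u 0 1 = 0.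
      transitivity (c' * (u 0 0 + c' * u 0 1) - (- u 0 1 + c' * u 0 0)); first by ring.
      by rewrite e0 e1; ring.
    have hc : 1 + c' ^+ 2 != 0 by rewrite gt_eqF // ltr_wpDr ?sqr_ge0.
    move: h0 h1 => /eqP; rewrite mulf_eq0 (negPf hc) => /eqP h0 /eqP.
    by rewrite mulf_eq0 (negPf hc) => /eqP h1; rewrite dotp2E h0 h1 !mul0r addr0 ltxx.
  exists i; rewrite ex dotpZr pmulr_rlt0 //.
  have -> : l = - (c *: u) by apply/eqP; rewrite -addr_eq0 e.
  by rewrite -scaleN1r !dotpZl mulN1r oppr_lt0 mulr_gt0 // upos.
have [i [x [x0 ex]]] := hray hne.
exists i; rewrite ex dotpZr pmulr_rlt0 //.
suff : dotp (l + c *: u) (to_rat g0) = 0.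
  by rewrite dotpDl dotpZl => h; have := mulr_gt0 c0 (upos _ g0s g0n0); lra.
by rewrite dotpDl dotpZl mulNr divfK ?subrr // gt_eqF ?upos.
Qed.

Definition distinct3 (i j k : 'I_3) := [/\ i != j, j != k & i != k].

Definition rdet i j : int := dotp (rotv (rho i)) (rho j).

Lemma rdetC i j : rdet j i = - rdet i j.
Proof. by rewrite /rdet !dotp_rotv; ring. Qed.

(** Cramer's rule for three plane vectors. *)
Lemma rdet_rel i j k :
  rdet j k *: rho i + rdet k i *: rho j + rdet i j *: rho k = 0.
Proof. by apply: rV2P; rewrite !mxE /rdet !dotp_rotv; ring. Qed.

Lemma distinct3P i j k l : distinct3 i j k -> [\/ l = i, l = j | l = k].
Proof.
case=> /eqP ij /eqP jk /eqP ik.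
case: (l =P i) => [->|li]; first exact: Or31.
case: (l =P j) => [->|lj]; first exact: Or32.
apply: Or33; have v (x y : 'I_3) : x <> y -> nat_of_ord x <> nat_of_ord y by move=> h /val_inj.
move: ij jk ik li lj; move: (ltn_ord i) (ltn_ord j) (ltn_ord k) (ltn_ord l).
by move=> hi hj hk hl /v a /v b /v c /v d /v e; apply: val_inj => /=; lia.
Qed.

(** The functional [rotv (rho i)] kills [rho i], and both it and its opposite are negative on some
    ray; so the other two rays lie strictly on opposite sides of the line through [rho i]. This is
    the form in which completeness enters the later sections. *)
Lemma rdet_neg i j k : distinct3 i j k -> rdet i j * rdet i k < 0.
Proof.
move=> hijk; have [_ hprim _ _] := hrho.
have hr : rotv (to_rat (rho i)) != 0.
  apply: contra (to_rat_neq0 (primitive_neq0 (hprim i))) => /eqP/rowP h.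
  apply/eqP/rV2P; first by have := h 1; rewrite !mxE.
  by have := h 0; rewrite !mxE => /eqP; rewrite oppr_eq0 => /eqP ->.
have e l : dotp (rotv (to_rat (rho i))) (to_rat (rho l)) = (rdet i l)%:~R.
  by rewrite /rdet !dotp_rotv !mxE rmorphB !rmorphM.
have [a] := rays_positively_span hr.
have hr' : - rotv (to_rat (rho i)) != 0 by rewrite oppr_eq0.
have [b] := rays_positively_span hr'.
rewrite -scaleN1r dotpZl mulN1r !e oppr_lt0 ltr0z ltrz0.
have d : rdet i i = 0 by rewrite /rdet dotp_rotv; ring.
by case: (distinct3P a hijk) => ->; case: (distinct3P b hijk) => ->;
  rewrite ?d ?ltxx //; nia.
Qed.

End FanPart.

(** * Relations between the rays *)

Lemma ray_mapE n d (rho : 'I_n -> 'rV[int]_d) u l : ray_map rho u 0 l = dotp u (rho l).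
Proof. by rewrite mxE. Qed.

Lemma rVBE (V : zmodType) n (u v : 'rV[V]_n) i : (u - v) 0 i = u 0 i - v 0 i.
Proof. by rewrite !mxE. Qed.

Lemma rVZE (R : pzRingType) n c (u : 'rV[R]_n) i : (c *: u) 0 i = c * u 0 i.
Proof. by rewrite mxE. Qed.

Lemma ray_mapD n d (rho : 'I_n -> 'rV[int]_d) u v :
  ray_map rho (u + v) = ray_map rho u + ray_map rho v.
Proof. by apply/rowP => l; rewrite !mxE dotpDl. Qed.

Lemma ray_mapZ n d (rho : 'I_n -> 'rV[int]_d) c u :
  ray_map rho (c *: u) = c *: ray_map rho u.
Proof. by apply/rowP => l; rewrite !mxE dotpZl. Qed.

Lemma ray_map0 n d (rho : 'I_n -> 'rV[int]_d) : ray_map rho 0 = 0.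
Proof. by apply/rowP => l; rewrite !mxE dotp0l. Qed.

Lemma ray_lattice0 n d (rho : 'I_n -> 'rV[int]_d) : ray_lattice rho 0.
Proof. by exists 0; rewrite ray_map0. Qed.

Lemma ray_latticeD n d (rho : 'I_n -> 'rV[int]_d) m m' :
  ray_lattice rho m -> ray_lattice rho m' -> ray_lattice rho (m + m').
Proof. by move=> [u ->] [v ->]; exists (u + v); rewrite ray_mapD. Qed.

Lemma ray_latticeZ n d (rho : 'I_n -> 'rV[int]_d) c m :
  ray_lattice rho m -> ray_lattice rho (c *: m).
Proof. by move=> [u ->]; exists (c *: u); rewrite ray_mapZ. Qed.

Lemma ray_latticeN n d (rho : 'I_n -> 'rV[int]_d) m :
  ray_lattice rho m -> ray_lattice rho (- m).
Proof. by rewrite -scaleN1r; apply: ray_latticeZ. Qed.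

Lemma ray_latticeB n d (rho : 'I_n -> 'rV[int]_d) m m' :
  ray_lattice rho m -> ray_lattice rho m' -> ray_lattice rho (m - m').
Proof. by move=> h h'; apply/ray_latticeD/ray_latticeN. Qed.

Lemma distinct3_21 i j k : distinct3 i j k -> distinct3 j i k.
Proof. by case=> a b c; split; rewrite // eq_sym. Qed.

Lemma distinct3_32 i j k : distinct3 i j k -> distinct3 i k j.
Proof. by case=> a b c; split; rewrite // eq_sym. Qed.

Lemma distinct3_312 i j k : distinct3 i j k -> distinct3 k i j.
Proof. by case=> a b c; split; rewrite // eq_sym. Qed.

Lemma distinct3_231 i j k : distinct3 i j k -> distinct3 j k i.
Proof. by case=> a b c; split; rewrite // eq_sym. Qed.

Lemma ex_neq3 (i : 'I_3) : exists j, i != j.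
Proof. by exists (if i == 0 then 1 else 0); case: ifP => [/eqP -> //|/negbT]. Qed.

Lemma distinct3_completion (i j : 'I_3) : i != j -> exists k, distinct3 i j k.
Proof.
move=> ij; have h (m : 'I_3) : val m = (3 - val i - val j)%N -> distinct3 i j m.
  move=> hm; have := ltn_ord i; have := ltn_ord j; have := ltn_ord m.
  move: ij hm; rewrite -val_eqE /= => ij hm h1 h2 h3.
  by split; rewrite -val_eqE /=; lia.
have hlt : (3 - i - j < 3)%N.
  by have := ltn_ord i; have := ltn_ord j; move: ij; rewrite -val_eqE /=; lia.
by exists (Ordinal hlt); apply: h.
Qed.

Lemma forall_distinct3 (P : 'I_3 -> Prop) i j k :
  distinct3 i j k -> P i -> P j -> P k -> forall l, P l.
Proof. by move=> h hi hj hk l; case: (distinct3P l h) => ->. Qed.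

Lemma big_distinct3 (R : Type) (idx : R) (op : Monoid.com_law idx) (F : 'I_3 -> R) i j k :
  distinct3 i j k -> \big[op/idx]_l F l = op (op (F i) (F j)) (F k).
Proof.
move=> h; have [ij jk ik] := h.
rewrite (bigD1 i) //= (bigD1 j) 1?eq_sym //= (bigD1 k) /=; last first.
  by rewrite eq_sym ik eq_sym jk.
rewrite big1 ?Monoid.mulm1 ?Monoid.mulmA // => l /andP [/andP [li lj] lk].
by case: (distinct3P l h) => e; rewrite e eqxx in li lj lk.
Qed.

Lemma ex_least (P : int -> Prop) n : P n -> (forall n, P n -> 0 < n) ->
  exists c, P c /\ forall n, P n -> c <= n.
Proof.
move=> Pn hpos; have [N hN] : exists N : nat, n = N%:Z.
  by exists `|n|%N; have := hpos _ Pn; lia.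
move: n hN Pn; elim/ltn_ind: N => N IH n hN Pn.
case: (classic (exists n', P n' /\ n' < n)) => [[n' [Pn' hn']]|hno].
  apply: (IH `|n'|%N _ n') => //; have := hpos _ Pn'; lia.
exists n; split=> // n' Pn'; rewrite leNgt; apply/negP => hlt.
by apply: hno; exists n'.
Qed.

(** The sign conditions, in the shape supplied by [rdet_neg], say that [a], [b] and [c] have the
    same sign. *)
Lemma pos_of_relation (a b c x y z : int) : x != 0 \/ y != 0 \/ z != 0 ->
  x <= 0 -> y <= 0 -> c * - b < 0 -> - c * a < 0 -> a * x + b * y + c * z = 0 -> 0 < z.
Proof.
move=> hn hx hy; rewrite mulrN mulNr !oppr_lt0 => hb ha e.
wlog c0 : a b c ha hb e / 0 < c.
  move=> hw; case: (ltP 0 c) => c0; first exact: (hw a b c).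
  have {}c0 : c < 0 by case: (altP (c =P 0)) ha => [->|cn _]; lia.
  apply: (hw (- a) (- b) (- c)); rewrite ?mulrNN ?oppr_gt0 //.
  by rewrite !mulNr -!opprD e oppr0.
have {}ha : 0 < a by rewrite -(pmulr_rgt0 _ c0).
have {}hb : 0 < b by rewrite -(pmulr_rgt0 _ c0).
have h1 : a * x <= 0 by rewrite pmulr_rle0.
have h2 : b * y <= 0 by rewrite pmulr_rle0.
rewrite ltNge; apply/negP => hz.
have h3 : c * z <= 0 by rewrite pmulr_rle0.
have /eqP : a * x = 0 by lia.
have /eqP : b * y = 0 by lia.
have /eqP : c * z = 0 by lia.
rewrite !mulf_eq0 (gt_eqF c0) (gt_eqF ha) (gt_eqF hb) => /eqP z0 /eqP y0 /eqP x0.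
by move: hn; rewrite x0 y0 z0; case=> [|[]].
Qed.

(* Entries of a sum of row vectors are typed through the algebraic hierarchy;
   [lia] recognizes equal atoms only once these types are unfolded to [int]. *)
Ltac rvlia := repeat match goal with
  | H : context [@fun_of_matrix ?T 1 3 ?M ?a ?b] |- _ =>
      lazymatch T with int => fail
      | _ => change (@fun_of_matrix T 1 3 M a b) with (@fun_of_matrix int 1 3 M 0 b) in H end
  | |- context [@fun_of_matrix ?T 1 3 ?M ?a ?b] =>
      lazymatch T with int => fail
      | _ => change (@fun_of_matrix T 1 3 M a b) with (@fun_of_matrix int 1 3 M 0 b) end
  end; lia.

Section Lattice.
Variable rho : 'I_3 -> 'rV[int]_2.
Hypothesis rho_primitive : forall i, primitive (rho i).
Hypothesis rdet_neg : forall i j k, distinct3 i j k -> rdet rho i j * rdet rho i k < 0.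

Notation L := (ray_lattice rho).

Lemma ray_lattice_pos m i j k : distinct3 i j k -> L m ->
  m 0 i <= 0 -> m 0 j <= 0 -> m != 0 -> 0 < m 0 k.
Proof.
move=> hijk [u ->] hi hj hn.
have h1 := rdet_neg hijk; have h2 := rdet_neg (distinct3_21 hijk).
have hrel : rdet rho j k * dotp u (rho i) + rdet rho k i * dotp u (rho j)
    + rdet rho i j * dotp u (rho k) = 0.
  by rewrite -!dotpZr -!dotpDr rdet_rel dotp0r.
move: hi hj h1 h2 hrel; rewrite !ray_mapE (rdetC rho k i) (rdetC rho i j).
have : dotp u (rho i) != 0 \/ dotp u (rho j) != 0 \/ dotp u (rho k) != 0.
  case: (altP (dotp u (rho i) =P 0)) => hi; last by left.
  case: (altP (dotp u (rho j) =P 0)) => hj; last by right; left.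
  case: (altP (dotp u (rho k) =P 0)) => hk; last by right; right.
  case/negP: hn; apply/eqP/rowP; apply: (forall_distinct3 hijk);
  by rewrite ray_mapE mxE.
exact: pos_of_relation.
Qed.

Lemma ray_lattice_neg m i j k : distinct3 i j k -> L m ->
  0 <= m 0 i -> 0 <= m 0 j -> m != 0 -> m 0 k < 0.
Proof.
move=> hijk /ray_latticeN hm hi hj hn.
by have := ray_lattice_pos hijk hm; rewrite !mxE oppr_eq0 !oppr_le0 oppr_gt0; apply.
Qed.

Lemma ray_lattice_le0 m i j k : distinct3 i j k -> L m ->
  m 0 i <= 0 -> m 0 j <= 0 -> m 0 k <= 0 -> m = 0.
Proof.
move=> hijk hm hi hj hk; apply/eqP; apply: contraTT hk => hn.
by rewrite -ltNge; apply: ray_lattice_pos hijk hm hi hj hn.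
Qed.

Lemma ex_ray_lattice1 i : exists2 m, L m & m 0 i = 1.
Proof.
have [u hu] := primitive_Bezout (@rho_primitive i).
by exists (ray_map rho u); rewrite ?ray_mapE //; exists u.
Qed.

(** Because [rho i] is primitive, its quarter turn generates the kernel; the sign is chosen to make
    the entry at [j] positive. *)
Lemma ker_coordinate i j k : distinct3 i j k -> exists u0,
  [/\ ray_map rho u0 0 i = 0, 0 < ray_map rho u0 0 j, ray_map rho u0 0 k < 0
    & forall u, ray_map rho u 0 i = 0 -> exists n : int, u = n *: u0].
Proof.
move=> hijk; have h := rdet_neg hijk.
have [w hw] := primitive_Bezout (@rho_primitive i).
have rii : dotp (rotv (rho i)) (rho i) = 0 by rewrite dotp_rotv; ring.
have gen u : ray_map rho u 0 i = 0 -> exists n : int, u = n *: rotv (rho i).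
  rewrite ray_mapE dotp2E => hu; move: hw; rewrite dotp2E => hw.
  (* The multiplier is the determinant of [w] and [u], where [w] pairs to 1 with [rho i]. *)
  exists (w 0 0 * u 0 1 - w 0 1 * u 0 0); apply: rV2P; rewrite !mxE /=.
    rewrite -[LHS]mulr1 -hw; transitivity (w 0 0 * (u 0 0 * rho i 0 0 + u 0 1 * rho i 0 1)
      - w 0 0 * u 0 1 * rho i 0 1 + w 0 1 * u 0 0 * rho i 0 1); first by ring.
    by rewrite hu; ring.
  rewrite -[LHS]mulr1 -hw; transitivity (w 0 1 * (u 0 0 * rho i 0 0 + u 0 1 * rho i 0 1)
      + w 0 0 * u 0 1 * rho i 0 0 - w 0 1 * u 0 0 * rho i 0 0); first by ring.
  by rewrite hu; ring.
case: (ltP 0 (rdet rho i j)) => hj.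
  exists (rotv (rho i)); rewrite !ray_mapE rii; split=> //.
  by rewrite -(pmulr_rlt0 _ hj).
have {}hj : rdet rho i j < 0.
  by rewrite lt_neqAle hj andbT; apply: contraTneq h => ->; rewrite mul0r.
exists (- rotv (rho i)); rewrite -scaleN1r !ray_mapZ !mxE rii mulr0 !mulN1r.
split; rewrite ?oppr_gt0 ?oppr_lt0 //; first by rewrite -(nmulr_rlt0 _ hj).
move=> u /gen [n ->]; exists (- n).
by rewrite scalerA mulrN1 opprK.
Qed.

Lemma ray_map_inj : injective (ray_map rho).
Proof.
move=> u v /eqP; rewrite -subr_eq0 => /eqP e.
have e' : ray_map rho (u - v) = 0 by rewrite -scaleN1r ray_mapD ray_mapZ scaleN1r.
have hd : distinct3 0 1 ord_max by [].
have [u0 [_ hj _ gen]] := ker_coordinate hd.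
have [|n en] := gen (u - v); first by rewrite e' mxE.
have : n * ray_map rho u0 0 1 = 0 by move/rowP/(_ 1): e'; rewrite en ray_mapZ !mxE.
move/eqP; rewrite mulf_eq0 (gt_eqF hj) orbF => /eqP n0.
by apply/eqP; rewrite -subr_eq0 en n0 scale0r.
Qed.

(* A relation [m] in [L] gives the binomial [x_i ^+ c - x ^ (m-)], where
   [x_i] does not occur in [x ^ (m-)]. *)
Definition monic_relation i (c : int) :=
  [/\ 0 < c & exists m, [/\ L m, m 0 i = c & forall l, l != i -> m 0 l <= 0]].

Definition least_monic i c :=
  monic_relation i c /\ forall c', monic_relation i c' -> c <= c'.

Lemma monic_relationP m i j k : distinct3 i j k -> L m -> 0 < m 0 i ->
  m 0 j <= 0 -> m 0 k <= 0 -> monic_relation i (m 0 i).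
Proof.
move=> h Lm mi mj mk; split=> //; exists m; split=> // l.
by case: (distinct3P l h) => ->; rewrite ?eqxx.
Qed.

Lemma ex_least_monic i : exists c, least_monic i c.
Proof.
suff [c hc] : exists c, monic_relation i c.
  by have [|c' [h1 h2]] := ex_least hc; [move=> n [] | exists c'; split].
have [j ij] := ex_neq3 i.
have [k hijk] := distinct3_completion ij.
have hkij := distinct3_312 hijk.
have [u0 [hk hi hj _]] := ker_coordinate hkij.
exists (ray_map rho u0 0 i); apply: (monic_relationP hijk) => //.
- by exists u0.
- exact: ltW.
by rewrite hk.
Qed.

Definition linear_relation := exists i, monic_relation i 1.

(** A relation with [i]-entry 1 splits off the [i]-th coordinate, and what remains is the kernel of
    that coordinate, generated by a single element. *)
Lemma linear_relation_basis : linear_relation ->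
  exists i j l (b c P Q : nat) (u1 u2 : 'rV[int]_2),
  [/\ distinct3 i j l, (0 < P)%N,
      [/\ ray_map rho u1 0 i = 1, ray_map rho u1 0 j = - b%:Z & ray_map rho u1 0 l = - c%:Z],
      [/\ ray_map rho u2 0 i = 0, ray_map rho u2 0 j = P%:Z & ray_map rho u2 0 l = - Q%:Z]
    & (0 < Q)%N /\ forall u, exists n : int, u = ray_map rho u 0 i *: u1 + n *: u2].
Proof.
move=> [i [_ [p [[u1 ->] pi pneg]]]].
have [j ij] := ex_neq3 i.
have [l hijl] := distinct3_completion ij; have [_ jl il] := hijl.
have pj : ray_map rho u1 0 j <= 0 by apply: pneg; rewrite eq_sym.
have pl : ray_map rho u1 0 l <= 0 by apply: pneg; rewrite eq_sym.
have [u2 [q_i qj ql gen]] := ker_coordinate hijl.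
exists i, j, l, (absz (ray_map rho u1 0 j)), (absz (ray_map rho u1 0 l)).
exists (absz (ray_map rho u2 0 j)), (absz (ray_map rho u2 0 l)), u1, u2.
split=> //; first by rvlia.
- by split=> //; rvlia.
- by split=> //; rvlia.
split=> [|u]; first by rvlia.
have [|n en] := gen (u - ray_map rho u 0 i *: u1).
  by rewrite -scaleNr ray_mapD ray_mapZ mxE rVZE pi mulr1 subrr.
by exists n; rewrite -en addrC subrK.
Qed.

(** * Minimal relations and Herzog's argument *)

Section Least.
Variable c : 'I_3 -> int.
Hypothesis c_least : forall i, least_monic i (c i).

Lemma least_le m i j k : distinct3 i j k -> L m -> 0 < m 0 i ->
  m 0 j <= 0 -> m 0 k <= 0 -> c i <= m 0 i.
Proof. by move=> h Lm hi hj hk; apply: (proj2 (@c_least i)); apply: monic_relationP h _ _ _ _. Qed.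

Lemma least_gt0 i : 0 < c i. Proof. by case: (@c_least i) => -[]. Qed.

(** Take an element of the lattice with [k]-entry 1 and reduce its [i]-entry modulo [c i] by
    multiples of [m], which leave the [k]-entry alone. The result, or the result minus [m], is a
    linear relation for [x_k]. *)
Lemma linear_relation_of_pure m i j k : distinct3 i j k -> L m ->
  m 0 i = c i -> m 0 j = - c j -> m 0 k = 0 -> linear_relation.
Proof.
move=> hijk Lm mi mj mk; exists k.
have hkij := distinct3_312 hijk.
have [v0 Lv0 v0k] := ex_ray_lattice1 k.
pose v := v0 - divz (v0 0 i) (c i) *: m.
have Lv : L v by apply/ray_latticeB/ray_latticeZ.
have vk : v 0 k = 1 by rewrite !mxE mk mulr0 subr0.
have ci := @least_gt0 i.
have vi : v 0 i = modz (v0 0 i) (c i) by rewrite !mxE mi.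
clearbody v; have vi0 : 0 <= v 0 i by rewrite vi modz_ge0 // gt_eqF.
have vic : v 0 i < c i by rewrite vi ltz_pmod.
have vn0 : v != 0 by apply/eqP => /rowP/(_ k); rewrite vk mxE.
have vj : v 0 j < 0.
  by apply: (@ray_lattice_neg v i k j (distinct3_32 hijk) Lv vi0 _ vn0); rewrite vk.
case: (ltP 0 (v 0 i)) => vi'; last by rewrite -vk; apply: (monic_relationP hkij); rewrite ?vk // ltW.
have Lw : L (v - m) by apply: ray_latticeB.
have wk : (v - m) 0 k = 1 by rewrite rVBE vk mk subr0.
rewrite -wk; apply: (monic_relationP hkij) => //; rewrite ?wk //.
  by rewrite rVBE mi subr_le0 ltW.
(* Minimality of [c j], applied to [- v], keeps the [j]-entry of [v - m] nonpositive. *)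
suff : c j <= - v 0 j by rewrite rVBE mj opprK; move: (v 0 j) (c j) => x y; rvlia.
have := @least_le (- v) j i k (distinct3_21 hijk) (ray_latticeN Lv).
by rewrite ![(- v) _ _]mxE vk; apply; rvlia.
Qed.

Hypothesis no_linear : ~ linear_relation.

(* If the j-entry of a minimal relation vanishes, adding the minimal relation
   of k gives another minimal relation, without zero entries. *)
Lemma full_support_aux m i j k : distinct3 i j k -> L m -> m 0 i = c i ->
  m 0 j = 0 -> m 0 k <= 0 -> exists m', [/\ L m', m' 0 i = c i, m' 0 j < 0 & m' 0 k < 0].
Proof.
move=> hijk Lm mi mj mk0.
have ci := @least_gt0 i; have ck := @least_gt0 k; have cj := @least_gt0 j.
have mn0 : m != 0 by apply/eqP => /rowP/(_ i); rewrite mi mxE => e; rewrite e ltxx in ci.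
have mk : m 0 k < 0.
  by apply: (ray_lattice_neg hijk Lm _ _ mn0); rewrite ?mi ?mj // ltW.
have hkij := distinct3_312 hijk.
have hle : c k <= - m 0 k.
  have := @least_le (- m) k i j hkij (ray_latticeN Lm).
  by rewrite ![(- m) _ _]mxE mj mi; apply; rvlia.
have hlt : c k < - m 0 k.
  rewrite lt_neqAle hle andbT; apply/eqP => e; apply: no_linear.
  by apply: (@linear_relation_of_pure m i k j (distinct3_32 hijk) Lm mi _ mj); rvlia.
have [[_ [r [Lr rk rneg]]] _] := @c_least k.
have [ij jk ik] := hijk.
have ri : r 0 i <= 0 by apply: rneg.
have rj : r 0 j <= 0 by apply: rneg.
have Lw : L (m + r) by apply: ray_latticeD.
have wi : (m + r) 0 i = c i + r 0 i by rewrite mxE mi.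
have wj : (m + r) 0 j = r 0 j by rewrite mxE mj add0r.
have wk : (m + r) 0 k = m 0 k + c k by rewrite mxE rk.
have wn0 : m + r != 0 by apply/eqP => /rowP/(_ k); rewrite wk mxE; rvlia.
have hjki := distinct3_231 hijk.
have wi0 : 0 < (m + r) 0 i by apply: (ray_lattice_pos hjki Lw _ _ wn0); rvlia.
have wic : c i <= (m + r) 0 i by apply: (least_le hijk Lw wi0); rvlia.
have ri0 : r 0 i = 0 by rvlia.
have rj0 : r 0 j < 0.
  have rn0 : r != 0 by apply/eqP => /rowP/(_ k); rewrite rk mxE => e; rewrite e ltxx in ck.
  have hikj := distinct3_32 hijk.
  by apply: (ray_lattice_neg hikj Lr _ _ rn0); rvlia.
by exists (m + r); split=> //; rvlia.
Qed.

Lemma full_support i j k : distinct3 i j k ->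
  exists m, [/\ L m, m 0 i = c i, m 0 j < 0 & m 0 k < 0].
Proof.
move=> hijk; have [ij jk ik] := hijk.
have [[_ [m [Lm mi mneg]]] _] := @c_least i.
have mj : m 0 j <= 0 by apply: mneg; rewrite eq_sym.
have mk : m 0 k <= 0 by apply: mneg; rewrite eq_sym.
case: (altP (m 0 j =P 0)) => mj0; first exact: (full_support_aux hijk Lm).
case: (altP (m 0 k =P 0)) => mk0.
  have [m' [h1 h2 h3 h4]] := full_support_aux (distinct3_32 hijk) Lm mi mk0 mj.
  by exists m'.
by exists m; split=> //; rvlia.
Qed.

(** If the [i]-entry of [p + q] were nonpositive, [p + q] would give a monic relation for [x_j] of
    exponent [c j + p 0 j], below the minimum; likewise with [i] and [j] exchanged. Then [- (p + q)]
    is a monic relation for [x_k], whence the last bound. *)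
Lemma full_support_sum p q i j k : distinct3 i j k -> L p -> L q ->
  p 0 i = c i -> p 0 j < 0 -> p 0 k < 0 ->
  q 0 i < 0 -> q 0 j = c j -> q 0 k < 0 ->
  [/\ 0 < (p + q) 0 i, 0 < (p + q) 0 j & (p + q) 0 k <= - c k].
Proof.
move=> hijk Lp Lq pi pj pk qi qj qk.
have Ls : L (p + q) by apply: ray_latticeD.
have si : (p + q) 0 i = c i + q 0 i by rewrite mxE pi.
have sj : (p + q) 0 j = p 0 j + c j by rewrite mxE qj.
have sk : (p + q) 0 k < 0 by rewrite mxE; rvlia.
have sn0 : p + q != 0 by apply/eqP => h; rewrite h mxE ltxx in sk.
have hkij := distinct3_312 hijk.
have hkji := distinct3_32 hkij.
have i0 : 0 < (p + q) 0 i.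
  rewrite ltNge; apply/negP => hi.
  have hj := ray_lattice_pos hkij Ls (ltW sk) hi sn0.
  have := least_le (distinct3_21 hijk) Ls hj hi (ltW sk); rvlia.
have j0 : 0 < (p + q) 0 j.
  rewrite ltNge; apply/negP => hj.
  have hi := ray_lattice_pos hkji Ls (ltW sk) hj sn0.
  have := least_le hijk Ls hi hj (ltW sk); rvlia.
split=> //.
have := @least_le (- (p + q)) k i j hkij (ray_latticeN Ls).
by rewrite ![(- (p + q)) _ _]mxE; rvlia.
Qed.

(** The bounds of [full_support_sum] for the three pairs show that [p + q + r] has only nonpositive
    entries, and such an element of the lattice is 0. *)
Lemma minimal_relations : exists i j k p q r,
  [/\ distinct3 i j k, [/\ L p, L q & L r] & p + q + r = 0] /\
  [/\ [/\ p 0 i = c i, p 0 j < 0 & p 0 k < 0], [/\ q 0 i < 0, q 0 j = c j & q 0 k < 0],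
      [/\ r 0 i < 0, r 0 j < 0 & r 0 k = c k] & r 0 i <= q 0 i].
Proof.
have h012 : distinct3 0 1 ord_max by [].
have h120 : distinct3 1 ord_max 0 by [].
have h201 : distinct3 ord_max 0 1 by [].
have [p [Lp p0 p1 p2]] := full_support h012.
have [q [Lq q1 q2 q0]] := full_support h120.
have [r [Lr r2 r0 r1]] := full_support h201.
have [_ _ s2] := full_support_sum h012 Lp Lq p0 p1 p2 q0 q1 q2.
have [_ _ s1] := full_support_sum h201 Lr Lp r2 r0 r1 p2 p0 p1.
have [_ _ s0] := full_support_sum h120 Lq Lr q1 q2 q0 r1 r2 r0.
have e : p + q + r = 0.
  apply: (ray_lattice_le0 h012); first by do 2?[apply: ray_latticeD].
  - by move: s0 p0; rewrite !mxE; rvlia.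
  - by move: s1 q1; rewrite !mxE; rvlia.
  - by move: s2 r2; rewrite !mxE; rvlia.
(* Exchanging the roles of [q] and [r] arranges the last inequality; it will keep [x_i] out of the
   monomial [x ^ (g + r)]. *)
case: (leP (r 0 0) (q 0 0)) => hrq.
  by exists 0, 1, ord_max, p, q, r.
exists 0, ord_max, 1, p, r, q; split; first by split=> //; rewrite addrAC.
by split=> //; apply: ltW.
Qed.

(** Meant for the difference [d] of two exponents of a form vanishing at [e], the first one free of
    [x_i] and with a small exponent of [x_j]. Since [- p 0 j < c j], a positive [j]-entry of [d] is
    too small for a monic relation for [x_j]. *)
Lemma partner_bound p q d i j k : distinct3 i j k -> L p -> L q ->
  p 0 i = c i -> p 0 j < 0 -> p 0 k < 0 ->
  q 0 i < 0 -> q 0 j = c j -> q 0 k < 0 ->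
  L d -> d != 0 -> d 0 i <= 0 -> d 0 j < - p 0 j -> c k <= d 0 k.
Proof.
move=> hijk Lp Lq pi pj pk qi qj qk Ld dn0 di dj.
have [_ + _] := full_support_sum hijk Lp Lq pi pj pk qi qj qk.
rewrite mxE qj => hcj.
have hkij := distinct3_312 hijk.
have hikj := distinct3_32 hijk.
case: (leP (d 0 j) 0) => dj0.
  have dk := ray_lattice_pos hijk Ld di dj0 dn0.
  exact: least_le hkij Ld dk di dj0.
have dk : 0 < d 0 k.
  rewrite ltNge; apply/negP => dk.
  by have := least_le (distinct3_21 hijk) Ld dj0 di dk; rvlia.
have dneg : d 0 i < 0.
  have hjki := distinct3_231 hijk.
  by apply: (ray_lattice_neg hjki Ld) => //; apply: ltW.
have dci : c i <= - d 0 i.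
  have := @least_le (- d) i j k hijk (ray_latticeN Ld).
  by rewrite ![(- d) _ _]mxE; rvlia.
(* The bound on [d 0 i] makes [d + p] a monic relation for [x_k], and [p 0 k] is negative. *)
have Ls : L (d + p) by apply: ray_latticeD.
have si : (d + p) 0 i <= 0 by rewrite mxE; rvlia.
have sj : (d + p) 0 j < 0 by rewrite mxE; rvlia.
have sn0 : d + p != 0 by apply/eqP => h; rewrite h mxE ltxx in sj.
have sk := ray_lattice_pos hijk Ls si (ltW sj) sn0.
have := least_le hkij Ls sk si (ltW sj); rewrite mxE; rvlia.
Qed.

End Least.
End Lattice.

(** * Ideals, supports and multiplicities *)

Section IdealTheory.
Variable A : comNzRingType.
Implicit Types (S I J : A -> Prop).

Definition is_ideal J :=
  [/\ J 0, forall x y, J x -> J y -> J (x + y) & forall a x, J x -> J (a * x)].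

Lemma ideal_gen_ideal S : is_ideal (ideal_gen S).
Proof.
split; first by exists [::]; rewrite big_nil.
- move=> x y [s [hs ->]] [t [ht ->]]; exists (s ++ t); rewrite big_cat; split=> // p.
  by rewrite mem_cat => /orP [/hs|/ht].
move=> a x [s [hs ->]]; exists [seq (a * p.1, p.2) | p <- s]; split.
  by move=> p /mapP [q /hs hq ->].
by rewrite big_map mulr_sumr; apply: eq_bigr => p _; rewrite mulrA.
Qed.

Lemma ideal_gen_incl S x : S x -> ideal_gen S x.
Proof.
move=> Sx; exists [:: (1, x)]; rewrite big_seq1 mul1r; split=> // p.
by rewrite inE => /eqP ->.
Qed.

Lemma ideal_gen_min S J : is_ideal J -> ideal_sub S J -> ideal_sub (ideal_gen S) J.
Proof.
move=> [J0 JD JM] hS x [s [hs ->]]; elim: s hs => [|p s IH] hs; first by rewrite big_nil.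
rewrite big_cons; apply: JD.
  by apply/JM/hS/hs; rewrite mem_head.
by apply: IH => q hq; apply: hs; rewrite inE hq orbT.
Qed.

Lemma is_ideal_opp J x : is_ideal J -> J x -> J (- x).
Proof. by case=> _ _ JM Jx; rewrite -mulN1r; apply: JM. Qed.

Lemma is_ideal_sum J (T : Type) (r : seq T) (P : pred T) F :
  is_ideal J -> (forall i, P i -> J (F i)) -> J (\sum_(i <- r | P i) F i).
Proof. by case=> J0 JD _ h; elim/big_ind: _. Qed.

Lemma ideal_pow_ideal I n : is_ideal (ideal_pow I n).
Proof. by case: n => [|n] //; apply: ideal_gen_ideal. Qed.

Lemma ideal_mul_incl I J a b : I a -> J b -> ideal_mul I J (a * b).
Proof. by move=> Ia Jb; apply: ideal_gen_incl; exists a, b. Qed.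

Lemma ideal_pow1 I x : I x -> ideal_pow I 1 x.
Proof. by move=> Ix; rewrite -[x]mulr1; apply: ideal_mul_incl. Qed.

Lemma ideal_powD I n m a b :
  ideal_pow I n a -> ideal_pow I m b -> ideal_pow I (n + m) (a * b).
Proof.
elim: n a => [|n IH] a ha hb.
  by have [_ _ h] := ideal_pow_ideal I m; apply: h.
have hid := ideal_pow_ideal I (n.+1 + m).
suff : ideal_pow I (n.+1 + m) (b * a) by rewrite mulrC.
have [J0 JD JM] := hid.
apply: (@ideal_gen_min _ (fun a => ideal_pow I (n.+1 + m) (b * a))) ha.
  split; first by rewrite mulr0.
    by move=> x y hx hy; rewrite mulrDr; apply: JD.
  by move=> c x hx; rewrite mulrCA; apply: JM.
move=> _ [x [y [Ix Iy ->]]]; rewrite mulrC -mulrA.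
exact: ideal_mul_incl (IH _ _ hb).
Qed.

Lemma ideal_pow_le I m n x : (m <= n)%N -> ideal_pow I n x -> ideal_pow I m x.
Proof.
move=> /subnK <-; elim: (n - m)%N x => [|d IH] x //.
apply: ideal_gen_min; first exact: ideal_pow_ideal.
move=> _ [a [b [_ hb ->]]]; have [_ _ JM] := ideal_pow_ideal I m.
exact/JM/IH.
Qed.

End IdealTheory.

Section Supports.
Variables (k : idomainType) (n : nat).
Implicit Types (f g : {mpoly k[n]}) (S T U : 'X_{1..n} -> Prop).

Definition supp_in S f := forall m, m \in msupp f -> S m.

Lemma supp_in0 S : supp_in S 0. Proof. by move=> m; rewrite msupp0. Qed.

Lemma supp_inX S m : S m -> supp_in S 'X_[m].
Proof. by move=> Sm m'; rewrite msuppX inE => /eqP ->. Qed.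

Lemma supp_inC S c : S 0%MM -> supp_in S c%:MP.
Proof. by move=> S0 m; rewrite msuppC; case: ifP => // _; rewrite inE => /eqP ->. Qed.

Lemma supp_inD S f g : supp_in S f -> supp_in S g -> supp_in S (f + g).
Proof. by move=> hf hg m /msuppD_le; rewrite mem_cat => /orP [/hf|/hg]. Qed.

Lemma supp_inN S f : supp_in S f -> supp_in S (- f).
Proof. by move=> hf m; rewrite (perm_mem (msuppN f)) => /hf. Qed.

Lemma supp_inM S T U f g : (forall m m', S m -> T m' -> U (m + m')%MM) ->
  supp_in S f -> supp_in T g -> supp_in U (f * g).
Proof.
by move=> h hf hg m /msuppM_le /allpairsP [[a b] /= [/hf ha /hg hb ->]]; apply: h.
Qed.

Lemma supp_in_sum S (I : Type) (r : seq I) (P : pred I) F :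
  (forall i, P i -> supp_in S (F i)) -> supp_in S (\sum_(i <- r | P i) F i).
Proof.
by move=> h; elim/big_ind: _ => //; [apply: supp_in0 | move=> x y; apply: supp_inD].
Qed.

Lemma supp_in_ideal S : (forall m m', S m -> S (m' + m)%MM) -> is_ideal (supp_in S).
Proof.
move=> h; split; [exact: supp_in0 | by move=> x y; apply: supp_inD | move=> a x].
by apply: (@supp_inM (fun=> True)) => // m m' _; apply: h.
Qed.

Lemma supp_in_mcoeff0 S f m : supp_in S f -> ~ S m -> f@_m = 0.
Proof. by move=> hf nS; apply: memN_msupp_eq0; apply/negP => /hf. Qed.

End Supports.

Section IntExp.
Variable n : nat.
Implicit Types (m : 'X_{1..n}) (v : 'rV[int]_n).

Lemma int_expE m i : int_exp m 0 i = (m i)%:Z. Proof. by rewrite mxE. Qed.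

Lemma int_expD m m' : int_exp (m + m')%MM = int_exp m + int_exp m'.
Proof. by apply/rowP => i; rewrite !mxE mnmDE. Qed.

Lemma int_exp0 : int_exp (0%MM : 'X_{1..n}) = 0.
Proof. by apply/rowP => i; rewrite !mxE mnm0E. Qed.

Lemma int_exp_inj : injective (@int_exp n).
Proof.
by move=> m m' /rowP h; apply/mnmP => i; move: (h i); rewrite !mxE => -[].
Qed.

Lemma pos_partE v i : pos_part v i = `|Num.max (v 0%R i) 0|%N.
Proof. by rewrite mnmE. Qed.

Lemma neg_partE v i : neg_part v i = `|- Num.min (v 0%R i) 0|%N.
Proof. by rewrite mnmE. Qed.

Lemma int_exp_pos_part v : (forall i, 0 <= v 0 i) -> int_exp (pos_part v) = v.
Proof.
move=> h; apply/rowP => i; rewrite mxE pos_partE; have := h i.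
by case: (v 0 i).
Qed.

Lemma int_exp_posneg v : int_exp (pos_part v) - int_exp (neg_part v) = v.
Proof.
apply/rowP => i; rewrite !mxE pos_partE neg_partE.
by move: (v 0 i) => x; lia.
Qed.

Lemma neg_partN v : neg_part v = pos_part (- v).
Proof.
by apply/mnmP => i; rewrite pos_partE neg_partE [(- v) _ _]mxE; move: (v 0 i) => x; lia.
Qed.

End IntExp.

(** * Linear functionals given by functions of the exponent *)

Section Pairing.
Variables (k : fieldType) (n : nat).
Implicit Types (f g : {mpoly k[n]}) (w : 'rV[int]_n -> k).

(** The weight [w] lives on all of Z^n, so that shifts by Laurent monomials are changes of weight. A
    character as weight evaluates at a point, and an indicator function extracts a coefficient. *)
Definition pairing f w : k := \sum_(m <- msupp f) f@_m * w (int_exp m).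

Lemma pairingE f w d : (msize f <= d)%N ->
  pairing f w = \sum_(m : 'X_{1..n < d}) f@_m * w (int_exp m).
Proof.
move=> hd; pose I : subFinType _ := 'X_{1..n < d}.
rewrite /pairing (big_mksub I) //=; first last.
  by move=> x /msize_mdeg_lt /leq_trans; apply.
  by rewrite msupp_uniq.
by rewrite big_rmcond //= => i; move/memN_msupp_eq0 ->; rewrite mul0r.
Qed.

Lemma pairingD f g w : pairing (f + g) w = pairing f w + pairing g w.
Proof.
pose d := maxn (msize f) (msize g).
rewrite !(@pairingE _ _ d) ?leq_maxl ?leq_maxr ?msizeD_le // -big_split /=.
by apply: eq_bigr => m _; rewrite mcoeffD mulrDl.
Qed.

Lemma pairingZ c f w : pairing (c *: f) w = c * pairing f w.
Proof.
rewrite !(@pairingE _ _ (msize f)) ?mmeasureZ_le // mulr_sumr.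
by apply: eq_bigr => m _; rewrite mcoeffZ mulrA.
Qed.

Lemma pairing0 w : pairing 0 w = 0.
Proof. by rewrite /pairing msupp0 big_nil. Qed.

Lemma pairingN f w : pairing (- f) w = - pairing f w.
Proof. by rewrite -scaleN1r pairingZ mulN1r. Qed.

Lemma pairing_sum (I : Type) (r : seq I) (P : pred I) F w :
  pairing (\sum_(i <- r | P i) F i) w = \sum_(i <- r | P i) pairing (F i) w.
Proof. by elim/big_rec2: _ => [|i x y _ <-]; rewrite ?pairing0 ?pairingD. Qed.

Lemma pairingX m w : pairing 'X_[m] w = w (int_exp m).
Proof. by rewrite /pairing msuppX big_seq1 mcoeffX eqxx mul1r. Qed.

Lemma pairing_eq f w w' : (forall v, w v = w' v) -> pairing f w = pairing f w'.
Proof. by move=> h; apply: eq_bigr => m _; rewrite h. Qed.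

Lemma pairingB_w f w w' : pairing f (fun v => w v - w' v) = pairing f w - pairing f w'.
Proof. by rewrite /pairing -sumrB; apply: eq_bigr => m _; rewrite mulrBr. Qed.

Lemma pairingZ_w f c w : pairing f (fun v => c * w v) = c * pairing f w.
Proof. by rewrite /pairing mulr_sumr; apply: eq_bigr => m _; rewrite mulrCA. Qed.

Lemma pairingM f g w :
  pairing (f * g) w = pairing f (fun v => pairing g (fun v' => w (v + v'))).
Proof.
rewrite {1}(mpolyE f) {1}(mpolyE g) mulr_suml pairing_sum.
apply: eq_bigr => m _; rewrite mulr_sumr pairing_sum /pairing mulr_sumr.
apply: eq_bigr => m' _; rewrite -scalerAl -scalerAr -mpolyXD.
by rewrite [LHS]pairingZ [in LHS]pairingZ pairingX int_expD.
Qed.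

Lemma pairing_delta f m : pairing f (fun x => (x == int_exp m)%:R) = f@_m.
Proof.
rewrite /pairing; case: (boolP (m \in msupp f)) => hm.
  rewrite (bigD1_seq m) ?msupp_uniq //= eqxx mulr1 big1 ?addr0 // => m' hne.
  by rewrite (inj_eq (@int_exp_inj _)) (negPf hne) mulr0.
rewrite memN_msupp_eq0 // big1_seq // => m' /andP [_ hm'].
rewrite (inj_eq (@int_exp_inj _)); case: eqP => [e|]; last by rewrite mulr0.
by rewrite e (negPf hm) in hm'.
Qed.

End Pairing.

(** * Equations on the big torus *)

Section TorusEquation.
Variables (k : fieldType) (rho : 'I_3 -> 'rV[int]_2).
Hypothesis rho_inj : injective (ray_map rho).
Implicit Types (f : {mpoly k[3]}) (g : {mpoly k[2]}).

(** The identity expressing [f] as [x ^ a] times the pullback of [g] along [ray_map], tested against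
    every weight; this avoids Laurent polynomials and is visibly multiplicative. *)
Definition torus_dual (f : {mpoly k[3]}) (g : {mpoly k[2]}) (a : 'rV[int]_3) :=
  forall w, pairing f w = pairing g (fun u => w (a + ray_map rho u)).

Lemma pairing_delta_coefZ (f : {mpoly k[3]}) v :
  pairing f (fun x => (x == v)%:R) = Defs.coefZ f v.
Proof.
rewrite /Defs.coefZ; case: ifP => [/forallP/int_exp_pos_part hv|/negbT hv].
  by rewrite -pairing_delta hv.
rewrite /pairing big1 // => m _; case: eqP => [e|]; last by rewrite mulr0.
by case/forallP: hv => i; rewrite -e mxE.
Qed.

Lemma coefZ_int_exp (f : {mpoly k[3]}) m : Defs.coefZ f (int_exp m) = f@_m.
Proof. by rewrite -pairing_delta_coefZ pairing_delta. Qed.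

Lemma torus_dual_equation f g a : torus_dual f g a -> torus_equation rho f g.
Proof.
move=> h; exists a; split=> [u|m hm].
  rewrite -pairing_delta_coefZ h -pairing_delta; apply: pairing_eq => v.
  by rewrite (inj_eq (addrI a)) (inj_eq rho_inj).
have : Defs.coefZ f (int_exp m) != 0.
  by rewrite coefZ_int_exp -mcoeff_msupp.
rewrite -pairing_delta_coefZ h /pairing => hne.
case: (boolP (has (fun u => a + ray_map rho (int_exp u) == int_exp m) (msupp g))).
  by move=> /hasP [u _ /eqP <-]; exists u.
move=> /hasPn hn; case/negP: hne; rewrite big1_seq // => u /andP [_ /hn /negPf ->].
by rewrite mulr0.
Qed.

Lemma torus_equation_dual f g : torus_equation rho f g -> exists a, torus_dual f g a.
Proof.
move=> [a [hg hsupp]]; exists a => w; rewrite {2}/pairing.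
transitivity (\sum_(u <- msupp g) \sum_(m <- msupp f)
   f@_m * (int_exp m == a + ray_map rho (int_exp u))%:R * w (int_exp m)); last first.
  apply: eq_bigr => u _; rewrite hg -pairing_delta_coefZ /pairing mulr_suml.
  by apply: eq_bigr => m _; case: eqP => [->|]; rewrite ?mulr0 ?mul0r.
rewrite exchange_big; apply: eq_big_seq => m hm /=.
have [u hu] := hsupp _ hm.
have hcoef : g@_u = f@_m by rewrite hg -hu coefZ_int_exp.
have hug : u \in msupp g by rewrite mcoeff_msupp hcoef -mcoeff_msupp.
rewrite (bigD1_seq u) ?msupp_uniq //= hu eqxx mulr1 big1 ?addr0 // => u' hne.
by rewrite (inj_eq (addrI a)) (inj_eq rho_inj) (inj_eq (@int_exp_inj _)) eq_sym (negPf hne) mulr0 mul0r.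
Qed.

Lemma torus_dualM f g a f' g' a' : torus_dual f g a -> torus_dual f' g' a' ->
  torus_dual (f * f') (g * g') (a + a').
Proof.
move=> h h' w; rewrite !pairingM h; apply: pairing_eq => u.
by rewrite h'; apply: pairing_eq => u'; rewrite ray_mapD addrACA.
Qed.

Lemma torus_equationM f g f' g' : torus_equation rho f g -> torus_equation rho f' g' ->
  torus_equation rho (f * f') (g * g').
Proof.
move=> /torus_equation_dual [a h] /torus_equation_dual [a' h'].
exact: torus_dual_equation (torus_dualM h h').
Qed.

Lemma torus_dual_sum (s : seq (k * ('X_{1..3} * 'X_{1..2}))) a :
  (forall p, p \in s -> int_exp p.2.1 = a + ray_map rho (int_exp p.2.2)) ->
  torus_dual (\sum_(p <- s) p.1 *: 'X_[p.2.1]) (\sum_(p <- s) p.1 *: 'X_[p.2.2]) a.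
Proof.
move=> h w; rewrite !pairing_sum; apply: eq_big_seq => p /h e.
by rewrite !pairingZ !pairingX e.
Qed.

Lemma mult_geM (e : 'I_2 -> k) f f' i i' : mult_ge rho e f i -> mult_ge rho e f' i' ->
  mult_ge rho e (f * f') (i + i').
Proof.
move=> [g hg gi] [g' hg' gi']; exists (g * g'); first exact: torus_equationM.
(* Truncation at 0 is subadditive, so the required power is at most the sum of the two given
   ones. *)
by apply: ideal_pow_le (ideal_powD gi gi'); lia.
Qed.

Lemma Cl_homogeneousM (f f' : {mpoly k[3]}) :
  Cl_homogeneous rho f -> Cl_homogeneous rho f' -> Cl_homogeneous rho (f * f').
Proof.
move=> h h' m1 m2 /msuppM_le /allpairsP [[a b] /= [ha hb ->]].
move=> /msuppM_le /allpairsP [[c d] /= [hc hd ->]].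
by rewrite !int_expD opprD addrACA; apply: ray_latticeD; [apply: h|apply: h'].
Qed.

Lemma cox_homogeneousM e (f f' : {mpoly k[3]}) i i' : cox_homogeneous rho e f i ->
  cox_homogeneous rho e f' i' -> cox_homogeneous rho e (f * f') (i + i').
Proof. by move=> [h m] [h' m']; split; [apply: Cl_homogeneousM | apply: mult_geM]. Qed.

Lemma Cl_homogeneousX m : Cl_homogeneous rho ('X_[m] : {mpoly k[3]}).
Proof.
move=> m1 m2; rewrite msuppX !inE => /eqP -> /eqP ->.
by rewrite subrr; apply: ray_lattice0.
Qed.

Lemma cox_homogeneousX e m i : i <= 0 -> cox_homogeneous rho e ('X_[m] : {mpoly k[3]}) i.
Proof.
move=> hi; split; first exact: Cl_homogeneousX.
exists 'X_[0]; last by rewrite (_ : Num.max i 0 = 0) //; lia.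
have := @torus_dual_sum [:: (1, (m, 0%MM))] (int_exp m).
rewrite !big_seq1 /= !scale1r => h; apply: torus_dual_equation (h _).
by move=> p; rewrite inE => /eqP -> /=; rewrite int_exp0 ray_map0 addr0.
Qed.

End TorusEquation.

(** * Testing multiplicity at a torus point by polynomial functions *)

Section Characters.
Variables (k : fieldType) (n : nat) (e : 'I_n -> k).
Hypothesis e_neq0 : forall j, e j != 0.
Implicit Types (u v : 'rV[int]_n) (g : {mpoly k[n]}).

Definition chareval u : k := \prod_j e j ^ u 0 j.

Lemma charevalD u v : chareval (u + v) = chareval u * chareval v.
Proof. by rewrite -big_split; apply: eq_bigr => j _; rewrite mxE expfzDr. Qed.

Lemma chareval0 : chareval 0 = 1.
Proof. by rewrite /chareval big1 // => j _; rewrite mxE expr0z. Qed.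

Lemma chareval_neq0 u : chareval u != 0.
Proof. by apply/prodf_neq0 => j _; rewrite expfz_neq0. Qed.

Lemma charevalZ c u : chareval (c *: u) = chareval u ^ c.
Proof.
rewrite /chareval; elim/big_rec2: _ => [|j x y _ ->]; first by rewrite exp1rz.
by rewrite mxE expfzMl exprz_exp [(u 0 j * c)%R]mulrC.
Qed.

Lemma chareval_U j : chareval (int_exp U_(j)%MM) = e j.
Proof.
rewrite /chareval (bigD1 j) //= big1 ?mulr1 => [|i ij]; rewrite mxE mnm1E.
  by rewrite eqxx.
by rewrite eq_sym (negPf ij).
Qed.

(* Polynomial functions of degree less than [d]. *)
Fixpoint poly_fun (d : nat) (psi : 'rV[int]_n -> k) : Prop :=
  if d is d'.+1 then forall v, poly_fun d' (fun u => psi (u + v) - psi u)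
  else forall u, psi u = 0.

Lemma poly_fun_ext d psi psi' : (forall u, psi u = psi' u) ->
  poly_fun d psi -> poly_fun d psi'.
Proof.
elim: d psi psi' => [|d IH] psi psi' h /= hp; first by move=> u; rewrite -h.
by move=> v; apply: IH (hp v) => u; rewrite !h.
Qed.

Lemma poly_funD d psi psi' : poly_fun d psi -> poly_fun d psi' ->
  poly_fun d (fun u => psi u + psi' u).
Proof.
elim: d psi psi' => [|d IH] psi psi' /= h h'; first by move=> u; rewrite h h' addr0.
by move=> v; apply: poly_fun_ext (IH _ _ (h v) (h' v)) => u; rewrite opprD addrACA.
Qed.

Lemma poly_funZ d c psi : poly_fun d psi -> poly_fun d (fun u => c * psi u).
Proof.
elim: d psi => [|d IH] psi /= h; first by move=> u; rewrite h mulr0.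
by move=> v; apply: poly_fun_ext (IH _ (h v)) => u; rewrite mulrBr.
Qed.

Lemma poly_fun_shift d v psi : poly_fun d psi -> poly_fun d (fun u => psi (u + v)).
Proof.
elim: d psi => [|d IH] psi /= h //.
by move=> v'; apply: poly_fun_ext (IH _ (h v')) => u; rewrite addrAC.
Qed.

(** By the product rule, the difference of [al * psi] is [al] times the difference of [psi], plus a
    constant times a shift of [psi]. The hypothesis on [al] says that its increments do not depend
    on the base point. *)
Lemma poly_fun_affine d (al : 'rV[int]_n -> k) psi :
  (forall u v, al (u + v) - al u = al v - al 0) ->
  poly_fun d psi -> poly_fun d.+1 (fun u => al u * psi u).
Proof.
move=> hal; elim: d psi => [|d IH] psi h v /=.
  by move=> u; rewrite !h !mulr0 subr0.
have hs : poly_fun d.+1 (fun u => (al v - al 0) * psi (u + v)).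
  exact/poly_funZ/poly_fun_shift.
apply: poly_fun_ext (poly_funD (IH _ (h v)) hs) => u.
by rewrite -(hal u v); ring.
Qed.

(** The functional acts as a differential operator of order less than [d] evaluated at [e].
    Multiplying the polynomial by ['X_j - (e j)%:MP] replaces [psi] by [e j] times its difference
    along the [j]-th basis vector, which lowers the degree. *)
Lemma ideal_pow_pairing d g psi : ideal_pow (point_ideal e) d g -> poly_fun d psi ->
  pairing g (fun u => chareval u * psi u) = 0.
Proof.
elim: d g psi => [|d IH] g psi hg hpsi.
  by rewrite /pairing big1 // => m _; rewrite hpsi !mulr0.
(* Quantifying over all multiples of [g] turns the vanishing condition into an ideal, so that
   generators suffice. *)
pose Z g := forall h, pairing (h * g) (fun u => chareval u * psi u) = 0.
suff : Z g by move=> /(_ 1); rewrite mul1r.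
have Zid : is_ideal Z.
  split; first by move=> h; rewrite mulr0 pairing0.
    by move=> x y hx hy h; rewrite mulrDr pairingD hx hy addr0.
  by move=> a x hx h; rewrite mulrA.
apply: (ideal_gen_min Zid) hg => _ [a [b [ha hb ->]]].
suff : Z (b * a) by rewrite mulrC.
have {Zid} Zid : is_ideal (fun a => Z (b * a)).
  have [Z0 ZD ZM] := Zid; split; rewrite ?mulr0 // => x y.
    by rewrite mulrDr; apply: ZD.
  by rewrite mulrCA; apply: ZM.
apply: (ideal_gen_min Zid) ha => _ [j ->] h.
have [_ _ JM] := ideal_pow_ideal (point_ideal e) d.
have := IH _ _ (JM h _ hb) (hpsi (int_exp U_(j)%MM)).
rewrite mulrA; move: (h * b) => {JM hb}b' hb'.
rewrite mulrBr pairingD pairingN [b' * _%:MP]mulrC mul_mpolyC pairingZ.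
rewrite [b' * _]mulrC pairingM pairingX -pairingZ_w -pairingB_w.
rewrite -[RHS](mulr0 (e j)) -[in RHS]hb' -pairingZ_w; apply: pairing_eq => u.
by rewrite charevalD chareval_U [int_exp _ + u]addrC; ring.
Qed.

Lemma point_idealX (u : 'X_{1..n}) : point_ideal e ('X_[u] - (chareval (int_exp u))%:MP).
Proof.
have [I0 ID IM] := ideal_gen_ideal (fun f => exists j, f = 'X_j - (e j)%:MP).
rewrite (multinomUE_id u); elim/big_ind: _ => [|x y hx hy|j _].
- by rewrite int_exp0 chareval0 mpolyX0 mpolyC1 subrr; apply: I0.
- rewrite mpolyXD int_expD charevalD mpolyCM.
  have -> : forall X Y x y : {mpoly k[n]}, X * Y - x * y = Y * (X - x) + x * (Y - y).
    by move=> X Y c d; ring.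
  by apply: ID; apply: IM.
elim: (u j) => [|i IH].
  by rewrite mulm0n int_exp0 chareval0 mpolyX0 mpolyC1 subrr; apply: I0.
rewrite mulmS mpolyXD int_expD charevalD mpolyCM.
have -> : forall X Y x y : {mpoly k[n]}, X * Y - x * y = Y * (X - x) + x * (Y - y).
  by move=> X Y c d; ring.
apply: ID; apply: IM => //; apply: ideal_gen_incl; exists j.
by rewrite chareval_U.
Qed.

(** Here [pairing g chareval] is the value of [g] at [e]. *)
Lemma point_ideal_pairing g : point_ideal e (g - (pairing g chareval)%:MP).
Proof.
have hid := ideal_gen_ideal (fun f => exists j, f = 'X_j - (e j)%:MP).
rewrite {1}(mpolyE g) /pairing (raddf_sum (@mpolyC n k)) -sumrB.
apply: is_ideal_sum => // m _.
by rewrite /= mpolyCM -mul_mpolyC -mulrBr; case: hid => _ _; apply; apply: point_idealX.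
Qed.

End Characters.

(** * The lattice ideal *)

Lemma mpolyX3 (K : comNzRingType) (v : 'X_{1..3}) i j k : distinct3 i j k ->
  'X_[K, v] = 'X_i ^+ v i * 'X_j ^+ v j * 'X_k ^+ v k.
Proof. by move=> h; rewrite mpolyXE_id (big_distinct3 _ _ h). Qed.

Lemma ex_linear_dependence (K : fieldType) (al be : 'I_3 -> K) :
  exists la : 'I_3 -> K, [/\ exists i, la i != 0, \sum_i la i * al i = 0
    & \sum_i la i * be i = 0].
Proof.
pose A := \matrix_(i < 3, j < 2) (if j == 0 then al i else be i).
pose v := nz_row (kermx A).
have vn0 : v != 0.
  rewrite nz_row_eq0 -mxrank_eq0 mxrank_ker subn_eq0 -ltnNge.
  exact: leq_ltn_trans (rank_leq_col A) _.
have vA : v *m A = 0 by apply/sub_kermxP/nz_row_sub.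
clearbody v; exists (fun i => v 0 i); split.
- apply/existsP; apply: contraNT vn0 => /existsPn h.
  by apply/eqP/rowP => i; rewrite mxE; apply/eqP; have := h i; rewrite negbK.
- transitivity ((v *m A) 0 0); last by rewrite vA mxE.
  rewrite [RHS]mxE; apply: eq_bigr => i _.
  by rewrite [A _ _]mxE.
transitivity ((v *m A) 0 1); last by rewrite vA mxE.
  rewrite [RHS]mxE; apply: eq_bigr => i _.
by rewrite [A _ _]mxE.
Qed.

Section LatticeIdeal.
Variables (k : fieldType) (rho : 'I_3 -> 'rV[int]_2).
Hypothesis rho_primitive : forall i, primitive (rho i).
Hypothesis rdet_neg : forall i j k, distinct3 i j k -> rdet rho i j * rdet rho i k < 0.

Notation L := (ray_lattice rho).
Notation IP := (@lattice_ideal k 3 L).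
Notation mm := (@irrelevant_ideal k 3).
Implicit Types (v w : 'X_{1..3}) (m : 'rV[int]_3).

Lemma lattice_ideal_ideal : is_ideal IP. Proof. exact: ideal_gen_ideal. Qed.

Lemma lattice_idealX v w : L (int_exp v - int_exp w) -> IP ('X_[v] - 'X_[w]).
Proof.
set m := _ - _ => Lm.
(* The greatest common divisor of the two monomials; the cofactors are the two terms of the binomial
   of [m]. *)
pose c : 'X_{1..3} := [multinom minn (v i) (w i) | i < 3].
have hv : v = (c + pos_part m)%MM.
  apply/mnmP => i; rewrite mnmDE mnmE pos_partE rVBE !int_expE.
  by move: (v i) (w i) => a b; lia.
have hw : w = (c + neg_part m)%MM.
  apply/mnmP => i; rewrite mnmDE mnmE neg_partE rVBE !int_expE.
  by move: (v i) (w i) => a b; lia.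
rewrite [in 'X_[v]]hv [in 'X_[w]]hw !mpolyXD -mulrBr.
have [_ _ IM] := lattice_ideal_ideal; apply: IM.
by apply: ideal_gen_incl; exists m.
Qed.

Lemma irrelevant_pow2_supp f : ideal_pow mm 2 f -> supp_in (fun v => 2 <= mdeg v)%N f.
Proof.
have up d : is_ideal (supp_in (fun v => d <= mdeg v)%N : {mpoly k[3]} -> Prop).
  by apply: supp_in_ideal => v w; rewrite mdegD => /leq_trans; apply; apply: leq_addl.
have h1 : ideal_sub mm (supp_in (fun v => 1 <= mdeg v)%N).
  by apply: ideal_gen_min => // _ [i ->]; apply: supp_inX; rewrite mdeg1.
apply: ideal_gen_min => // _ [a [b [/h1 ha hb ->]]].
have {}hb : supp_in (fun v => 1 <= mdeg v)%N b.
  move: b hb; apply: ideal_gen_min => // _ [c [d [/h1 hc _ ->]]].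
  by rewrite mulrC; case: (up 1%N) => _ _; apply.
by apply: supp_inM ha hb => v w hv hw; rewrite mdegD; apply: (@leq_add 1 1).
Qed.

Lemma irrelevant_pow2X v : (2 <= mdeg v)%N -> ideal_pow mm 2 'X_[v].
Proof.
have ex w : (0 < mdeg w)%N -> exists i w', w = (U_(i) + w')%MM.
  move=> hw; have [i hi] : exists i, w i != 0%N.
    apply/existsP; apply: contraLR hw => /existsPn h.
    rewrite -leqNgt leqn0 mdeg_eq0; apply/eqP/mnmP => i.
    by have := h i; rewrite negbK mnm0E => /eqP.
  exists i, (w - U_(i))%MM; rewrite addmC submK // lep1mP //.
have hX i : mm 'X_i by apply: ideal_gen_incl; exists i.
move=> hv; have [|i [w ew]] := ex v; first exact: leq_trans hv.
have [|j [w' ew']] := ex w; first by move: hv; rewrite ew mdegD mdeg1.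
rewrite ew ew' !mpolyXD; apply: ideal_mul_incl => //.
exact: ideal_mul_incl.
Qed.

Lemma linear_relation_not_sub : linear_relation rho -> ~ ideal_sub IP (ideal_pow mm 2).
Proof.
move=> [i [_ [m [Lm mi mneg]]]] /(_ ('X_[pos_part m] - 'X_[neg_part m])) h.
have /irrelevant_pow2_supp hs := h (ideal_gen_incl (ex_intro2 _ _ m Lm erefl)).
have hp : pos_part m = U_(i)%MM.
  apply/mnmP => l; rewrite pos_partE mnm1E; case: (altP (i =P l)) => [<-|il].
    by rewrite mi.
  have := mneg l; rewrite eq_sym il => /(_ isT).
  by move: (m 0 l) => x; lia.
have hn : neg_part m != U_(i)%MM.
  apply/eqP => /mnmP/(_ i); rewrite neg_partE mi mnm1E eqxx; lia.
have : ('X_[pos_part m] - 'X_[neg_part m] : {mpoly k[3]})@_U_(i) = 0.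
  by apply: supp_in_mcoeff0 hs _; rewrite mdeg1.
by move/eqP; rewrite mcoeffB !mcoeffX hp eqxx (negPf hn) subr0 oner_eq0.
Qed.

(** Both terms of each nonzero generator have degree at least 2: a positive part of degree 0 forces
    [m = 0], and one of degree 1 is a linear relation. *)
Lemma not_linear_relation_sub : ~ linear_relation rho -> ideal_sub IP (ideal_pow mm 2).
Proof.
move=> nolin; have aux m : L m -> m != 0 -> (2 <= mdeg (pos_part m))%N.
  move=> Lm mn0; rewrite ltnNge; apply/negP => hle.
  have h012 : distinct3 0 1 ord_max by [].
  have neg l : pos_part m l = 0%N -> m 0 l <= 0.
    by rewrite pos_partE; move: (m 0 l) => x; lia.
  have [h0|h1] : mdeg (pos_part m) = 0%N \/ mdeg (pos_part m) = 1%N by lia.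
    move/eqP: h0; rewrite mdeg_eq0 => /eqP h0.
    case/eqP: mn0; apply: (ray_lattice_le0 rdet_neg h012 Lm);
    by apply: neg; rewrite h0 mnm0E.
  move/eqP: h1 => /mdeg1P [i /eqP hi]; apply: nolin; exists i; split=> //.
  exists m; split=> //.
    have : pos_part m i = 1%N by rewrite hi mnm1E eqxx.
    by rewrite pos_partE; move: (m 0 i) => x; lia.
  by move=> l li; apply: neg; rewrite hi mnm1E eq_sym (negPf li).
apply: ideal_gen_min; first exact: ideal_pow_ideal.
move=> _ [m Lm ->]; have [J0 JD _] := ideal_pow_ideal mm 2.
case: (altP (m =P 0)) => [->|mn0].
  by rewrite neg_partN oppr0 subrr.
apply: JD; first by apply/irrelevant_pow2X/aux.
apply: is_ideal_opp; first exact: ideal_pow_ideal.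
apply: irrelevant_pow2X; rewrite neg_partN; apply: aux; first exact: ray_latticeN.
by rewrite oppr_eq0.
Qed.

Lemma not_sub_iff_linear_relation :
  ~ ideal_sub IP (ideal_pow mm 2) <-> linear_relation rho.
Proof.
split; last exact: linear_relation_not_sub.
by move=> h; apply: NNPP => /not_linear_relation_sub.
Qed.

(** The set consists of all monomials except the powers of [x_i] below the [c i]-th. It is stable
    under multiplication, and minimality of [c i] puts both terms of every nonzero generator in
    it. *)
Lemma lattice_ideal_supp (c : 'I_3 -> int) i : (forall i, least_monic rho i (c i)) ->
  ideal_sub IP (supp_in (fun v => c i <= (v i)%:Z \/ exists2 l, l != i & (0 < v l)%N)).
Proof.
move=> hc; set S := fun v => _.
have up v w : S v -> S (w + v)%MM.
  by case=> [h|[l li h]]; [left; rewrite mnmDE | right; exists l; rewrite // mnmDE]; lia.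
have hS m : L m -> m != 0 -> S (pos_part m).
  move=> Lm mn0.
  case: (classic (exists2 l, l != i & (0 < pos_part m l)%N)) => [|hno]; first by right.
  have neg l : l != i -> m 0 l <= 0.
    move=> li; rewrite leNgt; apply/negP => hl; apply: hno; exists l => //.
    by rewrite pos_partE; move: (m 0 l) hl => x; lia.
  have [j ij] := ex_neq3 i.
  have [l hijl] := distinct3_completion ij; have [_ jl il] := hijl.
  have mj : m 0 j <= 0 by apply: neg; rewrite eq_sym.
  have ml : m 0 l <= 0 by apply: neg; rewrite eq_sym.
  have mi : 0 < m 0 i.
    have hjli := distinct3_231 hijl.
    exact: (ray_lattice_pos rdet_neg hjli Lm).
  left; have := least_le hc hijl Lm mi mj ml.
  by rewrite pos_partE; move: (m 0 i) mi => x; lia.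
apply: ideal_gen_min; first exact: supp_in_ideal.
move=> _ [m Lm ->].
case: (altP (m =P 0)) => [->|mn0].
  by rewrite neg_partN oppr0 subrr; apply: supp_in0.
apply: supp_inD; first by apply: supp_inX; apply: hS.
apply: supp_inN; apply: supp_inX; rewrite neg_partN; apply: hS; first exact: ray_latticeN.
by rewrite oppr_eq0.
Qed.

Lemma linear_relation_of_CI : complete_intersection2 IP -> linear_relation rho.
Proof.
move=> [f [g hfg]].
have [c hc] := fin_all_exists (ex_least_monic rho_primitive rdet_neg).
have exM i : exists m : 'rV[int]_3,
    [/\ L m, m 0 i = c i & forall l, l != i -> m 0 l <= 0].
  by case: (hc i) => -[].
have [M hM] := fin_all_exists exM.
have cpos i : 0 < c i by exact: (least_gt0 hc i).
pose B i : {mpoly k[3]} := 'X_[pos_part (M i)] - 'X_[neg_part (M i)].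
have IB i : IP (B i) by apply: ideal_gen_incl; exists (M i) => //; case: (hM i).
have If : IP f by apply/hfg/ideal_gen_incl; left.
have Ig : IP g by apply/hfg/ideal_gen_incl; right.
have hab i : exists ab : {mpoly k[3]} * {mpoly k[3]}, B i = ab.1 * f + ab.2 * g.
  have : ideal_gen (fun y => y = f \/ y = g) (B i) by apply/hfg.
  apply: (@ideal_gen_min _ _ (fun x => exists ab : {mpoly k[3]} * {mpoly k[3]},
     x = ab.1 * f + ab.2 * g)).
    split; first by exists (0, 0); rewrite /= !mul0r addr0.
    - by move=> _ _ [ab ->] [ab' ->]; exists (ab.1 + ab'.1, ab.2 + ab'.2) => /=; ring.
    - by move=> a _ [ab ->]; exists (a * ab.1, a * ab.2) => /=; ring.
  by move=> x [->|->]; [exists (1, 0) | exists (0, 1)] => /=; ring.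
have [ab hAB] := fin_all_exists hab.
(* The constant terms of the coefficients of [f] and [g] are three vectors in a plane. A dependence
   between them puts the corresponding combination of the [B l] into the product of the irrelevant
   ideal with [IP]. *)
have [la [[i lai] hal hbe]] :=
  ex_linear_dependence (fun i => (ab i).1@_0%MM) (fun i => (ab i).2@_0%MM).
pose p : 'X_{1..3} := (U_(i) *+ `|c i|%N)%MM.
have pE l : p l = if l == i then `|c i|%N else 0%N.
  by rewrite /p mulmnE mnm1E eq_sym; case: (l == i); rewrite ?mul1n ?mul0n.
(* A factor without constant term raises the least possible power of [x_i] beyond [c i], so [x ^ p]
   cannot occur. *)
have coef0 h F : h@_0%MM = 0 -> IP F -> (h * F)@_p = 0.
  move=> h0 /(@lattice_ideal_supp c i hc) hF.
  apply: (@supp_in_mcoeff0 _ _ (fun v => c i < (v i)%:Z \/ exists2 l, l != i & (0 < v l)%N)).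
    have hn0 : supp_in (fun v => v != 0%MM) h.
      by move=> v hv; apply: contraTneq hv => ->; rewrite mcoeff_msupp h0 eqxx.
    apply: (supp_inM _ hn0 hF) => v w vn0 [hw|[l li wl]]; last first.
      by right; exists l; rewrite // mnmDE; lia.
    case: (classic (exists2 l, l != i & (0 < v l)%N)) => [[l li vl]|hno].
      by right; exists l; rewrite // mnmDE; lia.
    left; rewrite mnmDE; suff : (0 < v i)%N by lia.
    rewrite lt0n; apply: contra vn0 => /eqP vi; apply/eqP/mnmP => l.
    rewrite mnm0E; case: (altP (l =P i)) => [-> //|li].
    by apply/eqP; rewrite -leqn0 leqNgt; apply/negP => vl; apply: hno; exists l.
  case=> [|[l li]]; first by rewrite pE eqxx; have := cpos i; lia.
  by rewrite pE (negPf li).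
have hsum : \sum_l la l * (B l)@_p = 0.
  transitivity (((\sum_l la l *: (ab l).1) * f + (\sum_l la l *: (ab l).2) * g)@_p).
    rewrite !mulr_suml -big_split raddf_sum /=; apply: eq_bigr => l _.
    by rewrite hAB -!scalerAl -scalerDr mcoeffZ.
  rewrite mcoeffD !coef0 ?addr0 // raddf_sum /=.
    by rewrite -[RHS]hbe; apply: eq_bigr => l _; rewrite mcoeffZ.
  by rewrite -[RHS]hal; apply: eq_bigr => l _; rewrite mcoeffZ.
have posM l q : q != l -> pos_part (M l) q = 0%N.
  case: (hM l) => _ _ h /h; rewrite pos_partE; move: (M l 0 q) => x; lia.
have hpos l : (pos_part (M l) == p) = (l == i).
  apply/eqP/eqP => [e|->].
    apply/eqP; apply/negPn/negP; rewrite eq_sym => il.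
    have := posM l i il; rewrite e pE eqxx; have := cpos i; lia.
  apply/mnmP => q; rewrite pE; case: eqP => [->|/eqP qi]; last exact: posM.
  by rewrite pos_partE; case: (hM i) => _ -> _; have := cpos i; move: (c i) => x; lia.
have hnegi : (neg_part (M i) == p) = false.
  apply/eqP => /mnmP/(_ i); rewrite neg_partE pE eqxx.
  by case: (hM i) => _ -> _; have := cpos i; move: (c i) => x; lia.
(* The term [la i * x ^ p] from [B i] must cancel, and only the negative term of another [B j] can
   equal [x ^ p]; then [- M j] is a pure relation. *)
have [j ij hj] : exists2 j, i != j & neg_part (M j) = p.
  apply: NNPP => hno; case/eqP: lai; rewrite -[RHS]hsum (bigD1 i) //= big1 ?addr0.
    by rewrite mcoeffB !mcoeffX hpos eqxx hnegi subr0 mulr1.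
  move=> l li; rewrite mcoeffB !mcoeffX hpos (negPf li) sub0r.
  case: eqP => [e|]; last by rewrite oppr0 mulr0.
  by case: hno; exists l; rewrite // eq_sym.
have [l hijl] := distinct3_completion ij; have [_ jl il] := hijl.
have [LMj Mjj Mjneg] := hM j.
apply: (@linear_relation_of_pure _ rho_primitive rdet_neg c hc (- M j) i j l hijl).
- exact: ray_latticeN.
- rewrite mxE; have := Mjneg i ij; move/mnmP/(_ i): hj; rewrite neg_partE pE eqxx.
  by have := cpos i; move: (c i) (M j 0 i) => x y; lia.
- by rewrite mxE Mjj.
rewrite mxE; have := Mjneg l; rewrite eq_sym jl => /(_ isT).
move/mnmP/(_ l): hj; rewrite neg_partE pE eq_sym (negPf il).
by move: (M j 0 l) => x; lia.
Qed.

Lemma CI_of_linear_relation : linear_relation rho -> complete_intersection2 IP.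
Proof.
move/(linear_relation_basis rho_primitive rdet_neg).
move=> [i [j [l [b [c [P [Q [u1 [u0 [hijl _ [p_i pj pl] [q_i qj ql] [_ gen]]]]]]]]]]].
have [ij jl il] := hijl; pose p := ray_map rho u1.
have Lp : L p by exists u1.
pose x : {mpoly k[3]} := 'X_i; pose y : {mpoly k[3]} := 'X_j.
pose z : {mpoly k[3]} := 'X_l.
have XE v : 'X_[v] = x ^+ v i * y ^+ v j * z ^+ v l by apply: mpolyX3.
pose f := x - y ^+ b * z ^+ c; pose g := y ^+ P - z ^+ Q.
pose J := ideal_gen (fun h => h = f \/ h = g).
have [J0 JD JM] : is_ideal J by apply: ideal_gen_ideal.
have Jf : J f by apply: ideal_gen_incl; left.
have Jg : J g by apply: ideal_gen_incl; right.
have Jx n : J (x ^+ n - (y ^+ b * z ^+ c) ^+ n) by rewrite subrXX mulrC; apply: JM.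
have Jy n : J (y ^+ (P * n) - z ^+ (Q * n)) by rewrite !exprM subrXX mulrC; apply: JM.
exists f, g => F; split; last first.
  apply: ideal_gen_min; first exact: lattice_ideal_ideal.
  move=> _ [->|->].
    pose v : 'X_{1..3} := (U_(j) *+ b + U_(l) *+ c)%MM.
    have -> : f = 'X_i - 'X_[v] by rewrite mpolyXD -!mpolyXn.
    apply: lattice_idealX; suff -> : int_exp U_(i) - int_exp v = p by [].
    apply/rowP; apply: (forall_distinct3 hijl);
    rewrite rVBE !int_expE !(mnmDE, mulmnE, mnm1E) ?eqxx ?(negPf ij) ?(negPf il)
      ?[l == j]eq_sym ?(negPf jl) ?[j == i]eq_sym ?[l == i]eq_sym ?(negPf ij) ?(negPf il) ?p_i ?pj ?pl; lia.
  have -> : g = 'X_[U_(j) *+ P] - 'X_[U_(l) *+ Q] by rewrite -!mpolyXn.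
  apply: lattice_idealX; suff -> : int_exp (U_(j) *+ P)%MM - int_exp (U_(l) *+ Q)%MM = ray_map rho u0.
    by exists u0.
  apply/rowP; apply: (forall_distinct3 hijl);
  rewrite rVBE !int_expE !(mnmDE, mulmnE, mnm1E) ?eqxx ?(negPf ij) ?(negPf il)
    ?[l == j]eq_sym ?(negPf jl) ?[j == i]eq_sym ?[l == i]eq_sym ?(negPf ij) ?(negPf il) ?q_i ?qj ?ql; lia.
(* Congruence modulo [f] and [g]: the first eliminates [x], and the second trades [y ^+ P] for
   [z ^+ Q]. *)
pose sim h h' := J (h - h').
have simT h2 h1 h3 : sim h1 h2 -> sim h2 h3 -> sim h1 h3.
  by move=> h12 h23; rewrite /sim -(subrKA h2); apply: JD.
have simC h1 h2 : sim h1 h2 -> sim h2 h1.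
  by move=> h12; rewrite /sim -opprB; apply: is_ideal_opp.
have elim_x v : sim 'X_[v] (y ^+ (v j + b * v i) * z ^+ (v l + c * v i)).
  rewrite /sim XE !exprD !exprM.
  have -> : x ^+ v i * y ^+ v j * z ^+ v l - y ^+ v j * y ^+ b ^+ v i * (z ^+ v l * z ^+ c ^+ v i)
    = (y ^+ v j * z ^+ v l) * (x ^+ v i - (y ^+ b * z ^+ c) ^+ v i).
    by rewrite exprMn; ring.
  exact: JM.
have swap A B n : sim (y ^+ (A + P * n) * z ^+ B) (y ^+ A * z ^+ (B + Q * n)).
  rewrite /sim !exprD.
  have -> : forall a b c d : {mpoly k[3]}, a * b * c - a * (c * d) = a * c * (b - d).
    by move=> a1 b1 c1 d1; ring.
  exact: JM.
have simL v w : L (int_exp v - int_exp w) -> sim 'X_[v] 'X_[w].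
  move=> Lvw; apply: (simT _ _ _ (elim_x v)); apply: (simC _ _).
  apply: (simT _ _ _ (elim_x w)); apply: (simC _ _).
  have [u hu] := Lvw; have [n un] := gen u.
  have ui : ray_map rho u 0 i = (v i)%:Z - (w i)%:Z by rewrite -hu rVBE !int_expE.
  have coord q : (v q)%:Z - (w q)%:Z =
      ((v i)%:Z - (w i)%:Z) * p 0 q + n * ray_map rho u0 0 q.
    by rewrite -!int_expE -rVBE hu un ray_mapD !ray_mapZ mxE !rVZE ui !int_expE.
  have ej : (v j)%:Z - (w j)%:Z + ((v i)%:Z - (w i)%:Z) * b%:Z = n * P%:Z.
    by rewrite coord /p pj qj; ring.
  have el : (v l)%:Z - (w l)%:Z + ((v i)%:Z - (w i)%:Z) * c%:Z = - (n * Q%:Z).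
    by rewrite coord /p pl ql; ring.
  (* After elimination of [x] the exponents differ by [n] times the vector with entries [P] and
     [- Q]; the sign of [n] decides the direction of the exchange. *)
  case: n {un coord} ej el => n ej el.
    have -> : (v j + b * v i = (w j + b * w i) + P * n)%N by lia.
    have -> : (w l + c * w i = (v l + c * v i) + Q * n)%N by lia.
    exact: swap.
  have -> : (w j + b * w i = (v j + b * v i) + P * n.+1)%N by rewrite NegzE in ej; lia.
  have -> : (v l + c * v i = (w l + c * w i) + Q * n.+1)%N by rewrite NegzE in el; lia.
  exact/simC/swap.
apply: ideal_gen_min; first exact: ideal_gen_ideal.
by move=> _ [m Lm ->]; apply: simL; rewrite int_exp_posneg.
Qed.

Lemma CI_iff_linear_relation : complete_intersection2 IP <-> linear_relation rho.
Proof. by split; [apply: linear_relation_of_CI | apply: CI_of_linear_relation]. Qed.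

End LatticeIdeal.

(** * A form of multiplicity two *)

Section SecondOrder.
Variables (k : fieldType) (n : nat) (e : 'I_n -> k).
Hypothesis e_neq0 : forall j, e j != 0.

(** The monomial normalized to take the value 1 at [e]. *)
Let N (u : 'X_{1..n}) : {mpoly k[n]} := (chareval e (int_exp u))^-1 *: 'X_[u].

Let ND u v : N (u + v)%MM = N u * N v.
Proof.
by rewrite /N mpolyXD int_expD charevalD // invfM -scalerAl -scalerAr scalerA.
Qed.

Let N0 : N 0%MM = 1.
Proof. by rewrite /N int_exp0 chareval0 invr1 scale1r mpolyX0. Qed.

Let N_sub1 u : point_ideal e (N u - 1).
Proof.
have [_ _ JM] := ideal_gen_ideal (fun f => exists j, f = 'X_j - (e j)%:MP).
rewrite (_ : N u - 1 = (chareval e (int_exp u))^-1%:MP *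
  ('X_[u] - (chareval e (int_exp u))%:MP)).
  by apply: JM; apply: point_idealX.
by rewrite mulrBr mul_mpolyC -mpolyCM mulVf ?chareval_neq0 ?mpolyC1.
Qed.

Let lin u : {mpoly k[n]} := \sum_j (u j)%:R *: (N U_(j)%MM - 1).

(** Modulo the square of the maximal ideal [N u - 1] is additive in [u], because the cross term is a
    product of two elements vanishing at [e]. *)
Let N_taylor u : ideal_pow (point_ideal e) 2 (N u - 1 - lin u).
Proof.
have hid := ideal_pow_ideal (point_ideal e) 2; have [J0 JD JM] := hid.
have h0 : ideal_pow (point_ideal e) 2 (N 0%MM - 1 - lin 0%MM).
  rewrite N0 subrr /lin big1 ?subr0 // => j _.
  by rewrite mnm0E scale0r.
have hD u1 u2 : ideal_pow (point_ideal e) 2 (N u1 - 1 - lin u1) ->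
    ideal_pow (point_ideal e) 2 (N u2 - 1 - lin u2) ->
    ideal_pow (point_ideal e) 2 (N (u1 + u2)%MM - 1 - lin (u1 + u2)%MM).
  move=> h1 h2.
  have -> : lin (u1 + u2)%MM = lin u1 + lin u2.
    rewrite /lin -big_split; apply: eq_bigr => j _.
    by rewrite mnmDE natrD scalerDl.
  rewrite ND.
  have -> : N u1 * N u2 - 1 - (lin u1 + lin u2) =
    (N u1 - 1 - lin u1) + (N u2 - 1 - lin u2) + (N u1 - 1) * (N u2 - 1) by ring.
  apply: (JD); first exact: JD.
  by apply: ideal_mul_incl; [exact: N_sub1 | apply: ideal_pow1; exact: N_sub1].
have hU j : ideal_pow (point_ideal e) 2 (N U_(j)%MM - 1 - lin U_(j)%MM).
  rewrite /lin (bigD1 j) //= mnm1E eqxx scale1r big1 ?addr0 ?subrr // => i ij.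
  by rewrite mnm1E eq_sym (negPf ij) scale0r.
rewrite (multinomUE_id u); elim/big_ind: _ => // j _.
by elim: (u j) => [|i IH]; rewrite ?mulm0n // mulmS; apply: hD.
Qed.

(** A converse to [ideal_pow_pairing] in degree 2: replacing each normalized monomial by its Taylor
    remainder changes [g] only by combinations of the vanishing pairings. *)
Lemma ideal_pow2_of_pairing g : pairing g (chareval e) = 0 ->
  (forall j, pairing g (fun u => chareval e u * (u 0 j)%:~R) = 0) ->
  ideal_pow (point_ideal e) 2 g.
Proof.
move=> g0 g1; have hid := ideal_pow_ideal (point_ideal e) 2; have [J0 JD JM] := hid.
have -> : g = \sum_(u <- msupp g) (g@_u * chareval e (int_exp u)) *: (N u - 1 - lin u).
  under eq_bigr => u _ do rewrite !scalerBr.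
  rewrite !sumrB -scaler_suml -[X in X *: 1]/(pairing g (chareval e)) g0 scale0r subr0.
  rewrite [X in _ - X](_ : _ = 0) ?subr0.
    rewrite {1}[g]mpolyE; apply: eq_bigr => u _.
    by rewrite /N scalerA -mulrA divff ?mulr1 ?chareval_neq0.
  under eq_bigr => u _ do rewrite scaler_sumr.
  rewrite exchange_big big1 // => j _.
  under eq_bigr => u _ do rewrite scalerA.
  rewrite -scaler_suml -[X in X *: _](_ : pairing g (fun u => chareval e u * (u 0 j)%:~R) = _).
    by rewrite g1 scale0r.
  by apply: eq_bigr => u _; rewrite int_expE mulrA.
apply: is_ideal_sum => // u _; rewrite -mul_mpolyC; apply: JM; exact: N_taylor.
Qed.

End SecondOrder.

(** [G] is the least vector whose sums with 0, [p], [q] and [r] are all nonnegative; it is itself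
    nonnegative since [p + q + r = 0]. *)
Lemma triple_shift n (p q r : 'rV[int]_n) : p + q + r = 0 ->
  exists G (m0 m1 m2 m3 : 'X_{1..n}), [/\ int_exp m0 = G, int_exp m1 = G + p,
    int_exp m2 = G + q, int_exp m3 = G + r
    & forall l, G 0 l = Num.max (- p 0 l) (Num.max (- q 0 l) (- r 0 l))].
Proof.
move=> /rowP hsum.
pose G : 'rV[int]_n := \row_l Num.max (- p 0 l) (Num.max (- q 0 l) (- r 0 l)).
have GE l : G 0 l = Num.max (- p 0 l) (Num.max (- q 0 l) (- r 0 l)) by rewrite mxE.
have s0 l : p 0 l + q 0 l + r 0 l = 0 by have := hsum l; rewrite !mxE.
exists G, (pos_part G), (pos_part (G + p)), (pos_part (G + q)), (pos_part (G + r)).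
split=> //; apply: int_exp_pos_part => l; rewrite ?[(G + _) _ _]mxE GE; move: (s0 l);
by move: (p 0 l) (q 0 l) (r 0 l) => x y z; lia.
Qed.

Lemma mul_exprN2 (F : fieldType) (x t : F) M :
  t != 0 -> x * t ^ (- 2) * t ^+ M * t ^+ 2 = x * t ^+ M.
Proof. by move=> t0; rewrite -exprnN mulrAC divfK // expf_neq0. Qed.

Section CoxToLinear.
Variables (k : fieldType) (rho : 'I_3 -> 'rV[int]_2) (e : 'I_2 -> k).
Hypothesis rho_primitive : forall i, primitive (rho i).
Hypothesis rdet_neg : forall i j k, distinct3 i j k -> rdet rho i j * rdet rho i k < 0.
Hypothesis e_neq0 : forall j, e j != 0.

Notation L := (ray_lattice rho).
Let rho_inj := ray_map_inj rho_primitive rdet_neg.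

(** Otherwise [f] would be a single term, which is a unit on the torus and does not vanish at
    [e]. *)
Lemma vanishing_partner f m : cox_homogeneous rho e f 1 -> m \in msupp f ->
  exists m', [/\ m' \in msupp f, m' != m & L (int_exp m - int_exp m')].
Proof.
move=> [hom [g [a [hg hsupp]] hge]] hm.
apply: NNPP => hno; have [u hu] := hsupp _ hm.
have coefE v : Defs.coefZ f v != 0 -> v = int_exp m.
  rewrite /Defs.coefZ; case: ifP => [/forallP hv|]; last by rewrite eqxx.
  rewrite -mcoeff_msupp => hin; rewrite -(int_exp_pos_part hv); congr int_exp.
  apply/eqP; apply: contraT => hne; case: hno.
  by exists (pos_part v); split=> //; apply: hom.
have gu : g@_u = f@_m.
  by rewrite hg -hu coefZ_int_exp.
have h0 : pairing g (fun u => chareval e u * 1) = 0.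
  have hge1 : ideal_pow (point_ideal e) 1 g by exact: hge.
  by apply: (ideal_pow_pairing e_neq0 hge1) => v w /=; rewrite subrr.
have : pairing g (fun u => chareval e u * 1) != 0.
  have ug : u \in msupp g by rewrite mcoeff_msupp gu -mcoeff_msupp.
  rewrite /pairing (bigD1_seq u) ?msupp_uniq //= big1_seq ?addr0.
    by rewrite mulr1 mulf_neq0 ?chareval_neq0 // gu -mcoeff_msupp.
  move=> u' /andP [hne]; rewrite mcoeff_msupp hg => /coefE; rewrite hu => /addrI /rho_inj /int_exp_inj.
  by move/eqP; rewrite (negPf hne).
by rewrite h0 eqxx.
Qed.

Lemma linear_relation_of_cox : cox_generated_in_mult rho e 1 -> linear_relation rho.
Proof.
move=> [G [hG hgen]]; apply: NNPP => nolin.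
have [c hc] := fin_all_exists (ex_least_monic rho_primitive rdet_neg).
have [i [j [l [p [q [r [[hijl [Lp Lq Lr] hsum] [[p_i pj pl] [q_i qj ql] [r_i rj rl] hrq]]]]]]]] :=
  minimal_relations rho_primitive rdet_neg hc nolin.
have cl := least_gt0 hc l; have ci := least_gt0 hc i.
have [u1 e1] := Lp; have [u2 e2] := Lq.
pose u3 := - (u1 + u2).
have hu : u1 + u2 + u3 = 0 by rewrite subrr.
have e3 : r = ray_map rho u3.
  apply: (@addrI _ (p + q)); rewrite hsum e1 e2 -!ray_mapD hu.
  by rewrite ray_map0.
have [g [m0 [m1 [m2 [m3 [h0 h1 h2 h3 gE]]]]]] := triple_shift hsum.
have [w [t0 [t1 [t2 [t3 [s0 s1 s2 s3 _]]]]]] := triple_shift hu.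
(* The form [x ^ g * (x ^ p + x ^ q + x ^ r - 3)], twisted by the values of the
   characters at [e]: since [p + q + r = 0], it vanishes to order 2 at [e]. *)
pose a := g - ray_map rho w.
pose s := [:: ((chareval e u1)^-1, (m1, t1)); ((chareval e u2)^-1, (m2, t2));
              ((chareval e u3)^-1, (m3, t3)); (- 3%:R, (m0, t0))].
pose D : {mpoly k[3]} := \sum_(p <- s) p.1 *: 'X_[p.2.1].
pose D' : {mpoly k[2]} := \sum_(p <- s) p.1 *: 'X_[p.2.2].
have hdual : torus_dual rho D D' a.
  apply: torus_dual_sum => x; rewrite !inE => /or4P [] /eqP -> /=;
  rewrite ?h0 ?h1 ?h2 ?h3 ?s0 ?s1 ?s2 ?s3 ?ray_mapD -?e1 -?e2 -?e3 /a;
  by rewrite ?addrA ?subrK // [X in _ = X + _]addrNK.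
have chn u := chareval_neq0 e_neq0 u.
have hm2 : mult_ge rho e D 2.
  exists D'; first exact: (torus_dual_equation rho_inj hdual).
  have pE W : pairing D' W = \sum_(p <- s) p.1 * W (int_exp p.2.2).
    by rewrite pairing_sum; apply: eq_bigr => x _; rewrite pairingZ pairingX.
  apply: (ideal_pow2_of_pairing e_neq0) => [|b].
    rewrite pE !big_cons big_nil /= s0 s1 s2 s3 !charevalD //.
    have := chn u1; have := chn u2; have := chn u3; move: (chareval e w) => y.
    move: (chareval e u1) (chareval e u2) (chareval e u3) => x1 x2 x3 n3 n2 n1.
    by field; rewrite n1 n2 n3.
  rewrite pE !big_cons big_nil /= s0 s1 s2 s3 !charevalD //.
  have := chn u1; have := chn u2; have := chn u3; move: (chareval e w) => y.
  move: (chareval e u1) (chareval e u2) (chareval e u3) => x1 x2 x3 n3 n2 n1.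
  have hb : (u3 0 b)%:~R = - (u1 0 b)%:~R - (u2 0 b)%:~R :> k.
    by rewrite /u3 !mxE rmorphN rmorphD opprD.
  rewrite ![(w + _) _ _]mxE !rmorphD /= hb.
  move: ((w 0 b)%:~R) ((u1 0 b)%:~R) ((u2 0 b)%:~R) => z0 z1 z2.
  by field; rewrite n1 n2 n3.
have hhom : Cl_homogeneous rho D.
  have hin : supp_in (fun m => L (int_exp m - g)) D.
    rewrite /D big_seq; apply: supp_in_sum => x xs m /msuppZ_le.
    rewrite msuppX inE => /eqP ->; move: xs; rewrite !inE => /or4P [] /eqP -> /=;
    rewrite ?h0 ?h1 ?h2 ?h3 ?[g + _]addrC ?addrK //.
    by rewrite addNr; apply: ray_lattice0.
  move=> x y /hin hx /hin hy.
  rewrite (_ : _ - _ = (int_exp x - g) - (int_exp y - g)); first exact: ray_latticeB.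
  by rewrite opprB addrA subrK.
(* The [l]-entry tells [m3] from the other three exponents: it is positive for [r], negative for [p]
   and [q], and 0 for the zero vector. *)
have hcoef : m3 \in msupp D.
  have ne m M : int_exp m = M -> M 0 l != (g + r) 0 l -> (m == m3) = false.
    by move=> <-; rewrite -h3; apply: contraNF => /eqP ->.
  rewrite mcoeff_msupp /D raddf_sum /= !big_cons big_nil /= !mcoeffZ !mcoeffX eqxx.
  rewrite (ne m1 _ h1) ?(ne m2 _ h2) ?(ne m0 _ h0) ?mulr0 ?addr0 ?add0r ?mulr1 ?invr_eq0 ?chn //.
  - by rewrite [(g + r) _ _]mxE rl; rvlia.
  - by rewrite ![(g + _) _ _]mxE rl; rvlia.
  - by rewrite ![(g + _) _ _]mxE rl; rvlia.
(* The next bounds say that [x ^ m3 * t ^ (- 2)] fails each alternative of the condition [S] below.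
   The first one relies on [r 0 i <= q 0 i]. *)
have gi : g 0 i = - r 0 i by rewrite gE; rvlia.
have m3E b : (m3 b)%:Z = g 0 b + r 0 b by rewrite -int_expE h3 mxE.
have m3i : m3 i = 0%N by have := m3E i; rewrite gi; rvlia.
have m3j : (m3 j)%:Z < - p 0 j by rewrite m3E gE; have := least_gt0 hc j; rvlia.
have m3l : (m3 l)%:Z < c l + c l.
  have : p 0 l + q 0 l + r 0 l = 0 by move/rowP/(_ l): hsum; rewrite !mxE.
  by rewrite m3E gE rl; rvlia.
(* The monomials [m * t ^ (d - M)] with [S m d M] span a subalgebra.  It contains
   [t] and, by [partner_bound], the generators of multiplicity at most 1, but
   not the term [x ^ m3 * t ^ (- 2)] of [D * t ^ (- 2)]. *)
pose S (m : 'X_{1..3}) (d M : nat) := (0 < m i)%N \/ - p 0 j <= (m j)%:Z \/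
   M%:Z * c l <= (m l)%:Z + d%:Z * c l.
have SD m m' d d' M M' : S m d M -> S m' d' M' -> S (m + m')%MM (d + d')%N (M + M')%N.
  rewrite /S !mnmDE => -[h|[h|h]]; [by left; lia| by right; left; lia|].
  case=> [h'|[h'|h']]; [by left; lia| by right; left; lia|].
  right; right; rewrite !PoszD !mulrDl; lia.
pose R := {mpoly k[3]}.
pose good (P : {poly R}) M := forall d, supp_in (fun m => S m d M) P`_d.
have goodM P P' M M' : good P M -> good P' M' -> good (P * P') (M + M')%N.
  move=> hP hP' d; rewrite coefM; apply: supp_in_sum => b _.
  apply: (supp_inM _ (hP b) (hP' (d - b)%N)) => m m' h h'.
  by have := SD _ _ _ _ _ _ h h'; rewrite subnKC // -ltnS.
have goodX M : good 'X^M M.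
  move=> d; rewrite coefXn; case: eqP => [->|_]; last exact: supp_in0.
  by apply: supp_inC; right; right; rewrite mnm0E; lia.
have goodC (f : R) M : supp_in (fun m => S m 0%N M) f -> good f%:P M.
  by move=> hf d; rewrite coefC; case: eqP => [-> //|_]; apply: supp_in0.
have S0 m d : S m d 0%N by right; right; rewrite mul0r; have := ltW cl; rvlia.
(* Negative powers of [t] are cleared by a power [M], and [good] then constrains every coefficient
   of the resulting polynomial in [t]. *)
pose B (z : ambient k) := exists M (P : {poly R}), z * tvar k ^+ M = FracField.tofrac P /\ good P M.
have tE : tvar k = FracField.tofrac 'X by [].
have hB z : subalg_gen (fun w => w = tvar k \/ G w) z -> B z.
  elim=> {z} [b|z|z z' _ [M [P [eP gP]]] _ [M' [P' [eP' gP']]]|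
              z z' _ [M [P [eP gP]]] _ [M' [P' [eP' gP']]]].
  - exists 0%N, (b%:MP)%:P; split; first by rewrite mulr1.
    by apply: goodC => m _; apply: S0.
  - case=> [->|/hG [f [b [hf /andP [b0 b1] ->]]]].
      exists 0%N, 'X; split; first by rewrite mulr1.
      by move=> d m _; apply: S0.
    case: (altP (b =P 0)) => hb.
      exists 0%N, f%:P; split; first by rewrite /bihom hb oppr0 !mulr1.
      by apply: goodC => m _; apply: S0.
    have {b0 b1} hb1 : b = 1 by lia.
    exists 1%N, f%:P; split.
      rewrite /bihom hb1 mulfVK //.
      by rewrite tE tofrac_eq0 polyX_eq0.
    apply: goodC => m hm; rewrite hb1 in hf.
    have [m' [hm' hne Ld]] := vanishing_partner hf hm.
    case: (posnP (m i)) => mi; last by left.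
    case: (leP (- p 0 j) (m j)%:Z) => mj; first by right; left.
    right; right; rewrite mul1r mul0r addr0.
    have dE b' : (int_exp m - int_exp m') 0 b' = (m b')%:Z - (m' b')%:Z.
      by rewrite rVBE !int_expE.
    have := partner_bound rdet_neg hc hijl Lp Lq p_i pj pl q_i qj ql Ld.
    rewrite !dE subr_eq0 (inj_eq (@int_exp_inj _)) eq_sym hne mi => /(_ isT).
    move=> h; apply: le_trans (h _ _) _; rvlia.
  - exists (M + M')%N, (P * 'X^M' + P' * 'X^M); split.
      rewrite tofracD !tofracM -eP -eP' !tofracXn -tE exprD; ring.
    move=> d; rewrite coefD; apply: supp_inD; first exact: goodM.
    by rewrite addnC; apply: goodM.
  exists (M + M')%N, (P * P'); split; last exact: goodM.
  by rewrite tofracM -eP -eP' exprD; ring.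
have : cox_ring rho e (bihom D 2).
  exists [:: (1, bihom D 2)]; split; last by rewrite big_seq1 /kconst /in_ambient mpolyC1 polyC1 tofrac1 mul1r.
  by move=> x; rewrite inE => /eqP -> /=; exists D, 2.
move=> /hgen/hB [M [P [eP gP]]].
have tn0 : tvar k != 0 by rewrite tE tofrac_eq0 polyX_eq0.
have : D%:P * 'X^M = P * 'X^2.
  apply/eqP; rewrite -tofrac_eq !tofracM !tofracXn -tE -eP /bihom /in_ambient.
  by apply/eqP; symmetry; apply: (mul_exprN2 _ _ tn0).
(* Comparing coefficients of [t ^ M]: the form [D] is the coefficient of index [M - 2] of [P], or is
   0 if [M < 2]. *)
move/(congr1 (fun Q : {poly R} => Q`_M)); rewrite !coefMXn ltnn subnn coefC /=.
case: ifP => [_ D0|hM DE]; first by rewrite D0 msupp0 in hcoef.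
rewrite DE in hcoef; have := gP _ _ hcoef; case=> [|[|]]; first by rewrite m3i.
  by move: m3j; rvlia.
have -> : M%:Z = (M - 2)%N%:Z + 2 by lia.
by rewrite mulrDl; rvlia.
Qed.

End CoxToLinear.

(** * The Cox ring in the presence of a linear relation *)

Lemma natr_ffact (R : pzRingType) n k :
  (n ^_ k)%:R = \prod_(t < k) (n%:R - t%:R) :> R.
Proof.
elim: k => [|k IH]; first by rewrite big_ord0 ffactn0.
rewrite big_ord_recr /= -IH ffactnSr natrM.
have [le_kn|lt_nk] := leqP k n; first by rewrite natrB.
by rewrite ffact_small // !mul0r.
Qed.

Lemma poly_fun_prod_affine (k : fieldType) n d (al : 'I_d -> 'rV[int]_n -> k) D psi :
  (forall i u v, al i (u + v) - al i u = al i v - al i 0) ->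
  poly_fun D psi -> poly_fun (d + D)%N (fun u => \prod_i al i u * psi u).
Proof.
elim: d al => [|d IH] al hal hpsi.
  by apply: poly_fun_ext hpsi => u; rewrite big_ord0 mul1r.
have h := IH (fun i => al (lift ord0 i)) (fun i => hal _) hpsi.
by apply: poly_fun_ext (poly_fun_affine (hal ord0) h) => u; rewrite big_ord_recl mulrA.
Qed.

Lemma poly_fun_le (k : fieldType) n d D (psi : 'rV[int]_n -> k) :
  (d <= D)%N -> poly_fun d psi -> poly_fun D psi.
Proof.
move=> /subnK <- h.
(* The constant function 1 counts as an affine factor, so the degree bound can be raised freely. *)
apply: poly_fun_ext (@poly_fun_prod_affine k n (D - d) (fun _ _ => 1) d psi _ h).
  by move=> u; rewrite big1 ?mul1r.
by move=> i u v; rewrite !subrr.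
Qed.

Lemma euclid_shift (P A A0 : nat) (nu : int) : (0 < P)%N -> A%:Z - A0%:Z = nu * P%:Z ->
  (A %% P = A0 %% P)%N /\ (A %/ P)%N%:Z - (A0 %/ P)%N%:Z = nu.
Proof.
move=> P0; case: nu => n; rewrite ?NegzE => h.
  have -> : A = (n * P + A0)%N by lia.
  by rewrite modnMDl divnMDl //; split=> //; lia.
have -> : A0 = (n.+1 * P + A)%N by lia.
by rewrite modnMDl divnMDl //; split=> //; lia.
Qed.

(* Expand [S ^+ j = (la T + (S - la T)) ^+ j]: the coefficient of
   [(S - la T) ^+ l] is the [l]-th Taylor coefficient of [sum h_m w ^+ j_m] at [la]. *)
Lemma homogeneous_dvd (K : fieldType) (A : comAlgType K) (I : eqType) (r : seq I)
    (h : I -> K) (jn : I -> nat) (la : K) (S T : A) J N : la != 0 ->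
  (forall m, m \in r -> (jn m <= J)%N) ->
  (forall l, (l < N)%N -> \sum_(m <- r) h m * la ^+ jn m * 'C(jn m, l)%:R = 0) ->
  exists q, \sum_(m <- r) h m *: (S ^+ jn m * T ^+ (J - jn m)) = (S - la *: T) ^+ N * q.
Proof.
move=> la0 hJ hmom; pose W := S - la *: T.
have expand m : m \in r -> S ^+ jn m * T ^+ (J - jn m) =
   \sum_(l < J.+1) (la ^- l * (la ^+ jn m * 'C(jn m, l)%:R)) *: (W ^+ l * T ^+ (J - l)).
  move=> /hJ hm; have -> : S = la *: T + W by rewrite addrC subrK.
  rewrite exprDn mulr_suml.
  rewrite (big_ord_widen J.+1 (fun l => ((la *: T) ^+ (jn m - l) * W ^+ l *+ 'C(jn m, l)) * T ^+ (J - jn m))) ?ltnS //.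
  rewrite big_mkcond; apply: eq_bigr => l _; case: ifP => [|/negbT]; last first.
    by rewrite -leqNgt => hl; rewrite bin_small // !mulr0 scale0r.
  rewrite ltnS => hl; rewrite exprZn -scalerAl mulrnAl -scalerAl -scaler_nat scalerA.
  have -> : la ^- l * (la ^+ jn m * 'C(jn m, l)%:R) = 'C(jn m, l)%:R * la ^+ (jn m - l).
    rewrite -(subnK hl) exprD addnK; have := expf_neq0 l la0.
    by move: (la ^+ l) => x x0; field.
  congr (_ *: _); rewrite mulrAC -exprD mulrC; congr (_ * T ^+ _).
  by lia.
exists (\sum_(l < J.+1 | (N <= l)%N) (la ^- l * \sum_(m <- r) h m * la ^+ jn m * 'C(jn m, l)%:R)
   *: (W ^+ (l - N) * T ^+ (J - l))).
transitivity (\sum_(l < J.+1) (la ^- l * \sum_(m <- r) h m * la ^+ jn m * 'C(jn m, l)%:R)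
   *: (W ^+ l * T ^+ (J - l))).
  under eq_big_seq => m hm do rewrite (expand m hm) scaler_sumr.
  rewrite exchange_big; apply: eq_bigr => l _ /=.
  rewrite mulr_sumr scaler_suml; apply: eq_bigr => m _.
  by rewrite scalerA !mulrA [h m * _]mulrC.
rewrite (bigID (fun l : 'I__ => (N <= l)%N)) /= [X in _ + X]big1 ?addr0; last first.
  by move=> l; rewrite -ltnNge => /hmom ->; rewrite mulr0 scale0r.
rewrite mulr_sumr; apply: eq_bigr => l hl.
by rewrite -scalerAr mulrA -exprD subnKC.
Qed.

Lemma mul_tpow (F : fieldType) (x y q t : F) a b : t != 0 ->
  x ^+ a * (y ^+ b * q) * t ^ (- (a + b)%N%:Z) =
  (x * t ^ (- 1)) ^+ a * (y * t ^ (- 1)) ^+ b * q.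
Proof.
move=> t0; rewrite -exprnN exprD !exprMn -!exprnN !expr1 !exprVn.
by have := expf_neq0 a t0; have := expf_neq0 b t0; move: (t ^+ a) (t ^+ b) => u v hv hu; field; rewrite hu hv.
Qed.

Section LinearToCox.
Variables (k : fieldType) (rho : 'I_3 -> 'rV[int]_2) (e : 'I_2 -> k).
Hypothesis hk : [pchar k] =i pred0.
Hypothesis rho_primitive : forall i, primitive (rho i).
Hypothesis rdet_neg : forall i j k, distinct3 i j k -> rdet rho i j * rdet rho i k < 0.
Hypothesis e_neq0 : forall j, e j != 0.

Notation L := (ray_lattice rho).
Let rho_inj := ray_map_inj rho_primitive rdet_neg.

Lemma cox_homogeneous_binomial (v w : 'X_{1..3}) u :
  int_exp v - int_exp w = ray_map rho u ->
  cox_homogeneous rho e ('X_[v] - chareval e u *: 'X_[w]) 1.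
Proof.
move=> hu; split.
  have hin : supp_in (fun m => L (int_exp m - int_exp w)) ('X_[v] - chareval e u *: 'X_[w] : {mpoly k[3]}).
    apply: supp_inD; first by apply: supp_inX; exists u.
    by apply: supp_inN => m /msuppZ_le; rewrite msuppX inE => /eqP ->; rewrite subrr; apply: ray_lattice0.
  move=> x y /hin hx /hin hy.
  rewrite (_ : _ - _ = (int_exp x - int_exp w) - (int_exp y - int_exp w)); first exact: ray_latticeB.
  by rewrite opprB addrA subrK.
(* A degenerate triple suffices to obtain nonnegative exponents [m0] and [m1] differing by [u]. *)
have h0 : u + 0 + - u = 0 by rewrite addr0 subrr.
have [g [m0 [m1 [_ [_ [e0 e1 _ _ _]]]]]] := triple_shift h0.
pose s := [:: (1, (v, m1)); (- chareval e u, (w, m0))].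
have hd : torus_dual rho (\sum_(p <- s) p.1 *: 'X_[p.2.1]) (\sum_(p <- s) p.1 *: 'X_[p.2.2])
    (int_exp w - ray_map rho g).
  apply: torus_dual_sum => p; rewrite !inE => /orP [] /eqP -> /=; rewrite ?e0 ?e1 ?ray_mapD.
    by rewrite addrA subrK -hu addrC subrK.
  by rewrite subrK.
exists (\sum_(p <- s) p.1 *: 'X_[p.2.2]).
  have -> : 'X_[v] - chareval e u *: 'X_[w] = \sum_(p <- s) p.1 *: 'X_[p.2.1] :> {mpoly k[3]}.
    by rewrite !big_cons big_nil /= scale1r addr0 scaleNr.
  exact: (torus_dual_equation rho_inj hd).
suff : ideal_pow (point_ideal e) 1 (\sum_(p <- s) p.1 *: 'X_[p.2.2]) by [].
apply: ideal_pow1.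
have p0 : pairing (\sum_(p <- s) p.1 *: 'X_[p.2.2]) (chareval e) = 0.
  rewrite pairing_sum !big_cons big_nil /= !pairingZ !pairingX e0 e1 charevalD //; ring.
have := point_ideal_pairing e_neq0 (\sum_(p <- s) p.1 *: 'X_[p.2.2]).
by rewrite p0 mpolyC0 subr0.
Qed.

Lemma in_ambientD f g : in_ambient (f + g) = in_ambient f + in_ambient g :> ambient k.
Proof. by rewrite /in_ambient polyCD tofracD. Qed.

Lemma in_ambientM f g : in_ambient (f * g) = in_ambient f * in_ambient g :> ambient k.
Proof. by rewrite /in_ambient polyCM tofracM. Qed.

Lemma in_ambientX f d : in_ambient (f ^+ d) = in_ambient f ^+ d :> ambient k.
Proof. by rewrite /in_ambient polyC_exp tofracXn. Qed.

Lemma in_ambient0 : in_ambient 0 = 0 :> ambient k.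
Proof. by rewrite /in_ambient polyC0 tofrac0. Qed.

Lemma in_ambient1 : in_ambient 1 = 1 :> ambient k.
Proof. by rewrite /in_ambient polyC1 tofrac1. Qed.

Lemma tvar_neq0 : tvar k != 0.
Proof. by rewrite /tvar tofrac_eq0 polyX_eq0. Qed.

Lemma bihomM (f g : {mpoly k[3]}) a b : bihom f a * bihom g b = bihom (f * g) (a + b).
Proof.
rewrite /bihom in_ambientM opprD expfzDr ?tvar_neq0 //.
by rewrite mulrACA.
Qed.

Lemma bihomD (f g : {mpoly k[3]}) a : bihom (f + g) a = bihom f a + bihom g a.
Proof. by rewrite /bihom in_ambientD; exact: mulrDl. Qed.

Lemma bihom0 a : bihom (0 : {mpoly k[3]}) a = in_ambient 0.
Proof. by rewrite /bihom in_ambient0; exact: mul0r. Qed.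

Lemma kconstM c c' : kconst (c * c') = kconst c * kconst c' :> ambient k.
Proof. by rewrite /kconst mpolyCM in_ambientM. Qed.

Let S := subalg_gen (fun z => z = tvar k \/ exists f i,
  [/\ cox_homogeneous rho e f i, 0 <= i <= 1 & z = bihom f i]).

Lemma subalg_expr z d : S z -> S (z ^+ d).
Proof.
move=> hz; elim: d => [|d IH]; last by rewrite exprS; apply: subalg_mul.
by have := subalg_scalar (fun z => z = tvar k \/ exists f i,
  [/\ cox_homogeneous rho e f i, 0 <= i <= 1 & z = bihom f i]) 1;
  rewrite /kconst mpolyC1 in_ambient1.
Qed.

Lemma subalg_in_ambient f : S (in_ambient f).
Proof.
rewrite (mpolyE f); elim/big_ind: _ => [|x y hx hy|m _].
- by have := subalg_scalar (fun z => z = tvar k \/ exists f i,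
    [/\ cox_homogeneous rho e f i, 0 <= i <= 1 & z = bihom f i]) 0;
    rewrite /kconst mpolyC0.
- by rewrite in_ambientD; apply: subalg_add.
rewrite -mul_mpolyC in_ambientM; apply: subalg_mul; first exact: subalg_scalar.
apply: subalg_elt; right; exists 'X_[m], 0; split=> //.
  exact: cox_homogeneousX.
by rewrite /bihom oppr0 expr0z mulr1.
Qed.

Lemma subalg_cox_ring z : S z -> cox_ring rho e z.
Proof.
have gen f i : cox_homogeneous rho e f i -> cox_ring rho e (bihom f i).
  move=> hf; exists [:: (1, bihom f i)]; split.
    by move=> p; rewrite inE => /eqP -> /=; exists f, i.
  by rewrite big_seq1 /kconst mpolyC1 in_ambient1 mul1r.
have h1 i : i <= 0 -> cox_homogeneous rho e 1 i.
  by rewrite -mpolyX0; apply: cox_homogeneousX.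
elim=> {z} [c|z|z z' _ [s [hs ->]] _ [t [ht ->]]|z z' _ [s [hs ->]] _ [t [ht ->]]].
- exists [:: (c, bihom 1 0)]; split.
    by move=> p; rewrite inE => /eqP -> /=; exists 1, 0; split=> //; apply: h1.
  by rewrite big_seq1 /bihom in_ambient1 oppr0 expr0z !mulr1.
- case=> [->|[f [i [hf _ ->]]]]; last exact: gen.
  have -> : tvar k = bihom 1 (- 1) by rewrite /bihom in_ambient1 mul1r opprK.
  exact/gen/h1.
- exists (s ++ t); rewrite big_cat; split=> // p.
  by rewrite mem_cat => /orP [/hs|/ht].
exists [seq (x.1 * y.1, x.2 * y.2) | x <- s, y <- t]; split.
  move=> _ /allpairsP [[x y] /= [/hs [f [a [hf ->]]] /ht [g [b [hg ->]]] ->]] /=.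
  by exists (f * g), (a + b); rewrite bihomM; split=> //; apply: cox_homogeneousM.
rewrite big_allpairs_dep mulr_suml; apply: eq_bigr => x _.
rewrite mulr_sumr; apply: eq_bigr => y _ /=.
by rewrite kconstM mulrACA.
Qed.

(** * Expansion of a form in the two twisted binomials *)

Section Generators.
Variables (i j l : 'I_3) (b c P Q : nat) (u1 u2 : 'rV[int]_2).
Hypothesis hijl : distinct3 i j l.
Hypothesis P_gt0 : (0 < P)%N.
Hypothesis Q_gt0 : (0 < Q)%N.
Hypothesis u1E : [/\ ray_map rho u1 0 i = 1, ray_map rho u1 0 j = - b%:Z & ray_map rho u1 0 l = - c%:Z].
Hypothesis u2E : [/\ ray_map rho u2 0 i = 0, ray_map rho u2 0 j = P%:Z & ray_map rho u2 0 l = - Q%:Z].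
Hypothesis u12_basis : forall u, exists n : int, u = ray_map rho u 0 i *: u1 + n *: u2.

Let x : {mpoly k[3]} := 'X_i.
Let y : {mpoly k[3]} := 'X_j.
Let z : {mpoly k[3]} := 'X_l.
Let la1 := chareval e u1.
Let la2 := chareval e u2.
(** The two binomial generators of the lattice ideal, with coefficients twisted so that they vanish
    at [e]. *)
Let f := x - la1 *: (y ^+ b * z ^+ c).
Let g := y ^+ P - la2 *: z ^+ Q.

Let XE v : 'X_[v] = x ^+ v i * y ^+ v j * z ^+ v l. Proof. exact: mpolyX3. Qed.

Lemma cox_homogeneous_f : cox_homogeneous rho e f 1.
Proof.
have [ij jl il] := hijl; have [e1 e2 e3] := u1E.
have -> : f = 'X_i - la1 *: 'X_[(U_(j) *+ b + U_(l) *+ c)%MM].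
  by rewrite mpolyXD -!mpolyXn.
apply: cox_homogeneous_binomial; apply/rowP; apply: (forall_distinct3 hijl);
rewrite rVBE !int_expE !(mnmDE, mulmnE, mnm1E) ?eqxx ?(negPf ij) ?(negPf il)
  ?[l == j]eq_sym ?(negPf jl) ?[j == i]eq_sym ?[l == i]eq_sym ?(negPf ij) ?(negPf il) ?e1 ?e2 ?e3; lia.
Qed.

Lemma cox_homogeneous_g : cox_homogeneous rho e g 1.
Proof.
have [ij jl il] := hijl; have [e1 e2 e3] := u2E.
have -> : g = 'X_[U_(j) *+ P] - la2 *: 'X_[U_(l) *+ Q] by rewrite -!mpolyXn.
apply: cox_homogeneous_binomial; apply/rowP; apply: (forall_distinct3 hijl);
rewrite rVBE !int_expE !(mnmDE, mulmnE, mnm1E) ?eqxx ?(negPf ij) ?(negPf il)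
  ?[l == j]eq_sym ?(negPf jl) ?[j == i]eq_sym ?[l == i]eq_sym ?(negPf ij) ?(negPf il) ?e1 ?e2 ?e3; lia.
Qed.

Section Expansion.
Variables (F : {mpoly k[3]}) (n : nat).
Hypothesis hF : cox_homogeneous rho e F n%:Z.

Let A d (m : 'X_{1..3}) := (m j + b * (m i - d))%N.
Let B d (m : 'X_{1..3}) := (m l + c * (m i - d))%N.
(* [F = \sum_d f ^+ d * H d] is the expansion of [F] after the substitution
   [x = f + la1 *: (y ^+ b * z ^+ c)]. *)
Let H d : {mpoly k[3]} := \sum_(m <- msupp F | (d <= m i)%N)
  (F@_m * 'C(m i, d)%:R * la1 ^+ (m i - d)) *: (y ^+ A d m * z ^+ B d m).

Lemma f_expansion : F = \sum_(d < msize F) f ^+ d * H d.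
Proof.
rewrite {1}(mpolyE F) /H.
under [RHS]eq_bigr => d _ do rewrite mulr_sumr big_mkcond.
rewrite exchange_big; apply: eq_big_seq => m hm /=.
rewrite -big_mkcond /= XE.
have hlt : ((m i).+1 <= msize F)%N.
  apply: leq_ltn_trans (msize_mdeg_lt hm); rewrite mdegE (bigD1 i) //=.
  exact: leq_addr.
have {1}-> : x = la1 *: (y ^+ b * z ^+ c) + f by rewrite addrC subrK.
rewrite exprDn !mulr_suml scaler_sumr.
rewrite (big_ord_widen _ (fun d => F@_m *: (((la1 *: (y ^+ b * z ^+ c)) ^+ (m i - d) * f ^+ d *+ 'C(m i, d)) * y ^+ m j * z ^+ m l)) hlt).
apply: eq_bigr => d hd.
rewrite exprZn exprMn -!exprM /A /B !exprD.
rewrite -scalerAl -scaler_nat scalerA -!scalerAl scalerA -scalerAr.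
congr (_ *: _); first by ring.
by ring.
Qed.

(** [A 0] and [B 0] are the exponents of [y] and [z] after putting [x = y ^+ b * z ^+ c], which
    kills the direction [u1] and leaves multiples of [u2]. *)
Lemma supp_shift m m0 : m \in msupp F -> m0 \in msupp F -> exists nu : int,
  [/\ (A 0 m)%:Z - (A 0 m0)%:Z = nu * P%:Z, (B 0 m)%:Z - (B 0 m0)%:Z = - nu * Q%:Z
    & int_exp m - int_exp m0 = ray_map rho (((m i)%:Z - (m0 i)%:Z) *: u1 + nu *: u2)].
Proof.
move=> hm hm0; have [u hu] := (proj1 hF) _ _ hm hm0; have [nu eu] := u12_basis u.
have [a1 a2 a3] := u1E; have [b1 b2 b3] := u2E.
have ui : ray_map rho u 0 i = (m i)%:Z - (m0 i)%:Z by rewrite -hu rVBE !int_expE.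
have coord q : (m q)%:Z - (m0 q)%:Z =
    ((m i)%:Z - (m0 i)%:Z) * ray_map rho u1 0 q + nu * ray_map rho u2 0 q.
  by rewrite -!int_expE -rVBE hu eu ray_mapD !ray_mapZ mxE !rVZE ui !int_expE.
exists nu; split; last by rewrite hu {1}eu ui.
- rewrite /A !subn0 !PoszD !PoszM.
  have := coord j; rewrite a2 b2 => /eqP; rewrite subr_eq => /eqP ->; ring.
rewrite /B !subn0 !PoszD !PoszM.
have := coord l; rewrite a3 b3 => /eqP; rewrite subr_eq => /eqP ->; ring.
Qed.

Lemma AE d (m : 'X_{1..3}) : (d <= m i)%N -> (A d m)%:Z = (A 0 m)%:Z - (b * d)%:Z.
Proof. by move=> h; rewrite /A subn0 mulnBr; have := leq_mul2l b d (m i); rewrite h orbT; lia. Qed.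

Lemma BE d (m : 'X_{1..3}) : (d <= m i)%N -> (B d m)%:Z = (B 0 m)%:Z - (c * d)%:Z.
Proof. by move=> h; rewrite /B subn0 mulnBr; have := leq_mul2l c d (m i); rewrite h orbT; lia. Qed.

(* Vanishing of [g0] to order [n] at [e], tested against a polynomial function of
   degree [d + q] on the character lattice. *)
Lemma H_moment d q m0 : (d + q < n)%N -> m0 \in msupp F -> (d <= m0 i)%N ->
  \sum_(m <- msupp F | (d <= m i)%N)
    (F@_m * 'C(m i, d)%:R * la1 ^+ (m i - d)) * la2 ^+ (A d m %/ P) * 'C(A d m %/ P, q)%:R = 0.
Proof.
move=> hdq hm0 hd0.
have [_ [g0 /(torus_equation_dual rho_inj) [a hdual] hpow]] := hF.
have {}hpow : ideal_pow (point_ideal e) n g0.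
  by move: hpow; rewrite (_ : `|Num.max n%:Z 0|%N = n) //; lia.
have nat0 t : (t%:R == 0 :> k) = (t == 0)%N by have /pcharf0P -> := hk.
have natn0 t : (0 < t)%N -> t%:R != 0 :> k by rewrite nat0 -lt0n.
have la1n0 : la1 != 0 by apply: chareval_neq0.
have la2n0 : la2 != 0 by apply: chareval_neq0.
pose s := (A d m0 %% P)%N.
(* [AZ] extends [A d] to integer vectors. On the support all [A d m] are congruent modulo [P], so
   subtracting [s] and dividing by [P] gives the quotient [A d m %/ P]; [psi] is then a product of
   two falling factorials, of degree at most [d + q]. *)
pose AZ (v : 'rV[int]_3) := v 0 j + b%:Z * (v 0 i - d%:Z).
have AZ_D v v' : AZ (v + v') = AZ v + (v' 0 j + b%:Z * v' 0 i).
  by rewrite /AZ !mxE; ring.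
pose al1 (t : 'I_d) (v : 'rV[int]_3) : k := (v 0 i)%:~R - t%:R.
pose al2 (t : 'I_q) (v : 'rV[int]_3) : k := (AZ v - s%:Z)%:~R / P%:R - t%:R.
pose psi (v : 'rV[int]_3) : k := \prod_t al1 t v * (\prod_t al2 t v * 1).
pose w (v : 'rV[int]_3) : k := la1 ^ (v 0 i - (m0 i)%:Z) * la2 ^ (divz (AZ v - (A d m0)%:Z) P%:Z) * psi v.
have psi_poly : poly_fun n (fun u => psi (a + ray_map rho u)).
  apply: (@poly_fun_le _ _ (d + (q + 1))); first by rewrite addn1 addnS.
  apply: poly_fun_prod_affine.
    move=> t u v; rewrite /al1 ray_mapD ray_map0 addr0 addrA ![(_ + _ : 'rV_3) 0 i]mxE.
    by rewrite !rmorphD /=; ring.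
  apply: poly_fun_prod_affine; last by move=> u v /=; rewrite subrr.
  move=> t u v; rewrite /al2 ray_mapD ray_map0 addr0 addrA !(AZ_D).
  by rewrite !rmorphB !rmorphD /= ; field; apply: natn0.
have AZm (m : 'X_{1..3}) : (d <= m i)%N -> AZ (int_exp m) = (A d m)%:Z.
  by move=> h; rewrite /AZ !int_expE /A PoszD PoszM -subzn.
have hw : pairing F w = 0.
  rewrite hdual.
  have [t0 ht0] : exists u, int_exp m0 = a + ray_map rho u.
    apply: NNPP => hno; have := hm0; rewrite mcoeff_msupp => /eqP; case.
    rewrite -pairing_delta hdual /pairing big1 // => t _; case: eqP => [et|]; last by rewrite mulr0.
    by case: hno; exists (int_exp t).
  (* Decomposing [u - t0] in the basis [u1], [u2] shows that the powers of [la1] and [la2] in [w]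
     are the character at [e], up to a constant. *)
  have wE u : w (a + ray_map rho u) =
      (chareval e t0)^-1 * (chareval e u * psi (a + ray_map rho u)).
    rewrite /w [RHS]mulrA; congr (_ * _).
    have [nu eu] := u12_basis (u - t0).
    have [a1 a2 a3] := u1E; have [b1 b2 b3] := u2E.
    set nn := ray_map rho (u - t0) 0 i in eu.
    have ev : a + ray_map rho u = int_exp m0 + (nn *: ray_map rho u1 + nu *: ray_map rho u2).
      by rewrite ht0 -!ray_mapZ -ray_mapD -eu -addrA -ray_mapD addrC [_ + (u - t0)]addrC subrK addrC.
    have -> : (a + ray_map rho u) 0 i - (m0 i)%:Z = nn.
      by rewrite ev !mxE -!ray_mapE a1 b1; ring.
    have -> : divz (AZ (a + ray_map rho u) - (A d m0)%:Z) P%:Z = nu.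
      rewrite ev AZ_D AZm // ![(_ + _ : 'rV_3) 0 _]mxE !rVZE a1 a2 b1 b2.
      have -> : (A d m0)%:Z + (nn * - b%:Z + nu * P%:Z + b%:Z * (nn * 1 + nu * 0)) - (A d m0)%:Z
         = nu * P%:Z by ring.
      by rewrite mulzK // -lt0n.
    have -> : chareval e u = chareval e (u - t0) * chareval e t0.
      by rewrite -charevalD // subrK.
    rewrite mulrCA mulVf ?chareval_neq0 // mulr1 eu.
    by rewrite charevalD // !charevalZ.
  rewrite (pairing_eq _ wE) pairingZ_w (ideal_pow_pairing e_neq0 hpow) ?mulr0 //.
(* [C] undoes the normalization at [m0] and divides by factorials, which are invertible in
   characteristic 0; terms with [m i < d] drop out because their falling factorial vanishes. *)
pose C := la1 ^ ((m0 i)%:Z - d%:Z) * la2 ^+ (A d m0 %/ P) / (d`! * q`!)%:R.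
transitivity (C * pairing F w); last by rewrite hw mulr0.
rewrite /pairing mulr_sumr big_mkcond.
apply: eq_big_seq => m hm /=.
have prod1 : \prod_t al1 t (int_exp m) = (m i ^_ d)%:R.
  by rewrite natr_ffact; apply: eq_bigr => t _; rewrite /al1 int_expE.
case: ifP => [hd|/negbT]; last first.
  by rewrite -ltnNge => hd; rewrite /w /psi prod1 ffact_small // mul0r !mulr0.
have [nu [hA _ _]] := supp_shift hm hm0.
have hA' : (A d m)%:Z - (A d m0)%:Z = nu * P%:Z by rewrite (AE hd) (AE hd0) -hA; ring.
have [hmod hdiv] := euclid_shift P_gt0 hA'.
have prod2 : \prod_t al2 t (int_exp m) = ((A d m %/ P) ^_ q)%:R.
  rewrite natr_ffact; apply: eq_bigr => t _; rewrite /al2 AZm //; congr (_ - _).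
  rewrite {1}(divn_eq (A d m) P) hmod -/s PoszD addrK -pmulrn natrM mulfK //.
  exact: natn0.
rewrite /w /psi prod1 prod2 AZm // hA' mulzK -?lt0n // int_expE mulr1.
rewrite -!bin_ffact !natrM /C natrM.
have pw (r : k) (s1 s2 : int) : r != 0 -> r ^ (s1 - s2) = r ^ s1 / r ^ s2.
  by move=> r0; rewrite expfzDr // invr_expz.
have -> : la1 ^ ((m i)%:Z - (m0 i)%:Z) = la1 ^ ((m i - d)%N%:Z) / la1 ^ ((m0 i)%:Z - d%:Z).
  by rewrite -pw // -subzn //; congr (_ ^ _); ring.
have -> : la2 ^ nu = la2 ^+ (A d m %/ P) / la2 ^+ (A d m0 %/ P).
  by rewrite -hdiv pw.
rewrite -exprnP.
have := natn0 _ (fact_gt0 d); have := natn0 _ (fact_gt0 q).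
have : la1 ^ ((m0 i)%:Z - d%:Z) != 0 by rewrite expfz_neq0.
have : la2 ^+ (A d m0 %/ P) != 0 by rewrite expf_neq0.
move: (la1 ^ _) (la2 ^+ (A d m0 %/ P)) (d`!%:R) (q`!%:R) => r1 r2 r3 r4 h2 h1 h4 h3.
by field; rewrite h1 h2 h3 h4.
Qed.

(** Up to a fixed monomial, [H d] is a homogeneous form of degree [J] in [y ^+ P] and [z ^+ Q]; the
    moments say that its dehomogenization vanishes to order [n - d] at [la2]. *)
Lemma H_dvd d : (d < n)%N -> exists q, H d = g ^+ (n - d) * q.
Proof.
move=> hdn.
case: (boolP (has (fun m : 'X_{1..3} => (d <= m i)%N) (msupp F))) => [/hasP [m0 hm0 hd0]|]; last first.
  move=> /hasPn hno; exists 0; rewrite mulr0 /H big1_seq // => m /andP [hd hm].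
  by have := hno _ hm; rewrite hd.
pose J := (A d m0 %/ P + B d m0 %/ Q)%N.
have hm m : m \in msupp F -> (d <= m i)%N ->
    [/\ A d m = (A d m0 %% P + P * (A d m %/ P))%N, (A d m %/ P <= J)%N
      & B d m = (B d m0 %% Q + Q * (J - A d m %/ P))%N].
  move=> hm hd; have [nu [hA hB _]] := supp_shift hm hm0.
  have hA' : (A d m)%:Z - (A d m0)%:Z = nu * P%:Z by rewrite (AE hd) (AE hd0) -hA; ring.
  have hB' : (B d m)%:Z - (B d m0)%:Z = - nu * Q%:Z by rewrite (BE hd) (BE hd0) -hB; ring.
  have [hmA hdA] := euclid_shift P_gt0 hA'; have [hmB hdB] := euclid_shift Q_gt0 hB'.
  have hJ : (A d m %/ P + B d m %/ Q)%N = J by rewrite /J; lia.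
  split; first by rewrite -hmA mulnC addnC -divn_eq.
    by rewrite -hJ leq_addr.
  by rewrite -hmB -hJ addKn mulnC addnC -divn_eq.
have [||q hq] := @homogeneous_dvd k {mpoly k[3]} _ [seq m : 'X_{1..3} <- msupp F | (d <= m i)%N]
  (fun m : 'X_{1..3} => F@_m * 'C(m i, d)%:R * la1 ^+ (m i - d)) (fun m => A d m %/ P)%N la2
  (y ^+ P) (z ^+ Q) J (n - d) (chareval_neq0 e_neq0 u2).
- by move=> m; rewrite mem_filter => /andP [hd /hm/(_ hd) []].
- by move=> q hq; rewrite big_filter; apply: H_moment hm0 hd0; lia.
exists (y ^+ (A d m0 %% P) * z ^+ (B d m0 %% Q) * q).
rewrite mulrCA -hq big_filter mulr_sumr /H big_seq_cond [RHS]big_seq_cond.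
apply: eq_bigr => m /andP [hms hd]; have [eA _ eB] := hm _ hms hd.
rewrite -scalerAr; congr (_ *: _).
rewrite {1}eA {1}eB !exprD !exprM; ring.
Qed.

Lemma subalg_bihom : S (bihom F n%:Z).
Proof.
rewrite f_expansion; set K := msize F; clearbody K.
elim/big_ind: _ => [|h1 h2 hh1 hh2|[d _] _ /=].
- by rewrite bihom0; apply: subalg_in_ambient.
- by rewrite bihomD; apply: subalg_add.
have Sf : S (in_ambient f * tvar k ^ (- 1)).
  by apply: subalg_elt; right; exists f, 1; split=> //; apply: cox_homogeneous_f.
have Sg : S (in_ambient g * tvar k ^ (- 1)).
  by apply: subalg_elt; right; exists g, 1; split=> //; apply: cox_homogeneous_g.
(* For [d < n] the factor [t ^ (- n)] is shared between [f ^+ d] and [g ^+ (n - d)]; for larger [d]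
   it is absorbed by [f ^+ n]. *)
case: (ltnP d n) => hd.
  have [q ->] := H_dvd hd.
  have -> : n%:Z = (d + (n - d))%N%:Z by rewrite subnKC // ltnW.
  rewrite /bihom !in_ambientM !in_ambientX (mul_tpow _ _ _ _ _ tvar_neq0).
  by apply: subalg_mul; [apply: subalg_mul; apply: subalg_expr | apply: subalg_in_ambient].
have -> : f ^+ d * H d = f ^+ n * (g ^+ 0 * (f ^+ (d - n) * H d)).
  by rewrite expr0 mul1r mulrA -exprD subnKC.
have -> : n%:Z = (n + 0)%N%:Z by rewrite addn0.
rewrite /bihom in_ambientM [in_ambient (g ^+ 0 * _)]in_ambientM !in_ambientX (mul_tpow _ _ _ _ _ tvar_neq0).
by apply: subalg_mul; [apply: subalg_mul; apply: subalg_expr | apply: subalg_in_ambient].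
Qed.

End Expansion.
End Generators.

Lemma cox_of_linear_relation : linear_relation rho -> cox_generated_in_mult rho e 1.
Proof.
move/(linear_relation_basis rho_primitive rdet_neg).
move=> [i [j [l [b [c [P [Q [u1 [u2 [hijl P0 h1 h2 [Q0 gen]]]]]]]]]]].
exists (fun z => exists f i, [/\ cox_homogeneous rho e f i, 0 <= i <= 1 & z = bihom f i]).
split=> // z; split; last exact: subalg_cox_ring.
move=> [s [hs ->]]; rewrite big_seq; elim/big_ind: _ => [|x y hx hy|p /hs [f [d [hf ->]]]].
- by rewrite -in_ambient0; apply: subalg_in_ambient.
- exact: subalg_add.
apply: subalg_mul; first exact: subalg_scalar.
(* A negative multiplicity means a form times a positive power of [t]. *)
case: d hf => d hf; first exact: (subalg_bihom hijl P0 Q0 h1 h2 gen hf).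
rewrite /bihom NegzE opprK; apply: subalg_mul; first exact: subalg_in_ambient.
by apply: subalg_expr; apply: subalg_elt; left.
Qed.

End LinearToCox.

(** * The equivalence *)

Theorem proposition3p4 (k : closedFieldType) (hk : [pchar k] =i pred0)
    (Sigma : seq (seq 'rV[int]_2)) (hSigma : complete_fan Sigma)
    (rho : 'I_3 -> 'rV[int]_2) (hrho : primitive_ray_generators Sigma rho)
    (e : 'I_2 -> k) (he : forall j, e j != 0) :
  let I_P : {mpoly k[3]} -> Prop := lattice_ideal (ray_lattice rho) in
  (cox_generated_in_mult rho e 1 <->
     ~ ideal_sub I_P (ideal_pow (@irrelevant_ideal k 3) 2)) /\
  (~ ideal_sub I_P (ideal_pow (@irrelevant_ideal k 3) 2) <->
     complete_intersection2 I_P).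
Proof.
move=> I_P; have [_ rho_primitive _ _] := hrho.
have rho_det i j l := @rdet_neg _ _ hSigma hrho i j l.
have not_sub := @not_sub_iff_linear_relation k _ rho_det.
have CI := @CI_iff_linear_relation k _ rho_primitive rho_det.
split; last by split=> [/not_sub|] h; [apply/CI | apply/not_sub/CI].
split=> [h|/not_sub h].
  exact/not_sub/(linear_relation_of_cox rho_primitive rho_det he).
exact: (cox_of_linear_relation hk rho_primitive rho_det he).
Qed.
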